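(* Let $T>0$ and consider the market with two risky assets $S^1,S^2$ with semi-Markov stochastic volatilities $\sigma^{(1)}(x_t,\gamma(t))$, $\sigma^{(2)}(x_t,\gamma(t))$ described in the context, with $(x_0,\gamma(0))=(x,0)$. Put $$X=Cov_R(S^1,S^2)=\frac1T\int_0^T\rho_t\,\sigma^{(1)}(x_t,\gamma(t))\,\sigma^{(2)}(x_t,\gamma(t))\,dt,$$ $$Y=\frac1T\int_0^T(\sigma^{(1)}(x_t,\gamma(t)))^2dt,\qquad Z=\frac1T\int_0^T(\sigma^{(2)}(x_t,\gamma(t)))^2dt,$$ and $Y_0=\mathbb{E}\{Y\}$, $Z_0=\mathbb{E}\{Z\}$. Let $Corr_R(S^1,S^2)=\frac{X}{\sqrt{Y}\sqrt{Z}}$ be the realized correlation. Then the value of the correlation swap, $P_{corr}(x)=\mathbb{E}\{e^{-rT}(Corr_R(S^1,S^2)-K_{corr})\}$, is $$P_{corr}(x)\approx e^{-rT}\left\{\frac{\int_0^T\rho_t\,e^{tQ}[\sigma^{(1)}(x,0)\sigma^{(2)}(x,0)]\,dt}{\sqrt{\int_0^Te^{tQ}(\sigma^{(1)}(x,0))^2dt}\,\sqrt{\int_0^Te^{tQ}(\sigma^{(2)}(x,0))^2dt}}-K_{corr}\right\},$$ where $\approx$ means that $Corr_R(S^1,S^2)$ has been replaced by its zero-order approximation $\frac{X}{\sqrt{Y_0}\sqrt{Z_0}}$; that is, the right-hand side of the displayed formula for $P_{corr}(x)$ is exactly equal to $e^{-rT}\left(\mathbb{E}\left\{\frac{X}{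\sqrt{Y_0}\sqrt{Z_0}}\right\}-K_{corr}\right)$.
   Context: Semi-Markov process. Let $(X,\mathscr{X})$ be a measurable space (the state space; not to be confused with the random variable $X$ of the claim) and $Q_{SM}(x,B,t)=P(x,B)G_x(t)$ ($x\in X$, $B\in\mathscr{X}$, $t\ge 0$) a semi-Markov kernel, where $P$ is a transition probability kernel on $X$ and $G_x$ is a distribution function on $\mathbb{R}_+$ with density $g_x(t)=\frac{dG_x(t)}{dt}$; write $\overline{G}_x(t)=1-G_x(t)$. Let $(x_n,\tau_n)_{n\in\mathbb{N}}$ be a Markov renewal process with this kernel, i.e. $\mathbb{P}(x_{n+1}\in B,\tau_{n+1}-\tau_n\le t\mid\mathscr{F}_n)=Q_{SM}(x_n,B,t)$. Put $\nu(t)=\sup\{n:\tau_n\le t\}$, $x_t=x_{\nu(t)}$ (the semi-Markov process) and $\gamma(t)=t-\tau_{\nu(t)}$ (the backward recurrence time). The pair $(x_t,\gamma(t))_{t\ge0}$ is a Markov process on $X\times\mathbb{R}_+$ with generator $$Qf(x,t)=\frac{df}{dt}(x,t)+\frac{g_x(t)}{\overline{G}_x(t)}\int_X P(x,dy)\,[f(y,0)-f(x,t)].$$ The process starts at $(x_0,\gamma(0))=(x,0)$. Notation. $(e^{tQ})_{t\ge0}$ is the operator semigroup generated by $Q$, acting on functions on $X\times\mathbb{R}_+$; $e^{tQ}[\sigma^{(1)}(x,0)\sigma^{(2)}(x,0)]$ means $e^{tQ}$ applied to the product function $\sigma^{(1)}\sigma^{(2)}$, evaluated at $(x,0)$, and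 similarly $e^{tQ}(\sigma^{(i)}(x,0))^2=(e^{tQ}(\sigma^{(i)})^2)(x,0)$. Market. The risky assets satisfy $dS^{i}_t=S^{i}_t(\mu^{(i)}_t\,dt+\sigma^{(i)}(x_t,\gamma(t))\,dw^{(i)}_t)$, $i=1,2$, where $\mu^{(1)},\mu^{(2)}$ are deterministic functions of time, $\sigma^{(1)},\sigma^{(2)}$ are functions on $X\times\mathbb{R}_+$, and $w^{(1)},w^{(2)}$ are standard Wiener processes, independent of $(x,\gamma)$, with $d[w^{(1)}_t,w^{(2)}_t]=\rho_t\,dt$ for a deterministic function $\rho_t$. There is also a risk-free bond with rate $r$. $\mathbb{E}$ is taken in the risk-neutral world (minimal martingale measure), under which $(x_t,\gamma(t))_{t\ge0}$ is a Markov process on $X\times\mathbb{R}_+$ with generator $Q$ started at $(x,0)$. $K_{corr}$ is a constant (the strike); the notional amount is $1$. The functions $\sigma^{(i)}$ and $\rho$ are understood to be such that the displayed expressions are well defined (in particular $Y_0,Z_0>0$). *)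

(* Defs.v *)
From HB Require Import structures.
From mathcomp Require Import all_boot all_order all_algebra.
From mathcomp Require Import all_classical all_reals all_analysis.
Set Implicit Arguments.
Unset Strict Implicit.
Unset Printing Implicit Defensive.
Import Order.TTheory GRing.Theory Num.Theory.
Import numFieldNormedType.Exports.
Local Open Scope classical_set_scope.
Local Open Scope ring_scope.

(* Conventions.  Functions on X x R_+ are represented by functions on X x R;
   their values at negative ages never matter.  A function of a time or age
   variable is only looked at for nonnegative arguments. *)

Section SemiMarkovKernel.
Context {d : measure_display} {X : measurableType d} {R : realType}.
Variables (P : R.-pker X ~> X) (G g : X -> R -> R).

Definition diff_quotient (u : R -> R) (t h : R) : R := (u (t + h) - u t) / h.

(* Increments keeping the argument in R_+: a two-sided derivative at t > 0, a
   right derivative at t = 0. *)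
Definition incr_filter (t : R) : set_system R :=
  within [set h : R | 0 <= t + h] (0 : R)^'.

(* Each G_x is a distribution function on R_+ with density g_x = dG_x/dt; the
   pointwise derivative is only required where 1 - G_x(t) > 0, which is where
   the generator below involves g_x(t). *)
Record sojourn_law : Prop := {
  sojourn_measurable : forall t : R, 0 <= t -> measurable_fun setT (G ^~ t);
  density_measurable : forall x : X, measurable_fun `[(0 : R), +oo[ (g x);
  density_ge0 : forall (x : X) (t : R), 0 <= t -> 0 <= g x t;
  sojourn_density : forall (x : X) (t : R), 0 <= t ->
    (G x t)%:E = (\int[lebesgue_measure]_(s in `[0%R, t]) (g x s)%:E)%E;
  sojourn_derivative : forall (x : X) (t : R), 0 <= t -> G x t < 1 ->
    diff_quotient (G x) t h @[h --> incr_filter t] --> g x t;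
  sojourn_proper : forall x : X, G x t @[t --> +oo] --> (1 : R) }.

Definition semi_markov_kernel (x : X) (B : set X) (t : R) : \bar R :=
  (P x B * (G x t)%:E)%E.

(* The part of X x R_+ on which the hazard rate g_x(t) / (1 - G_x(t)) is
   defined; it is all of X x R_+ when the G_x have unbounded support.  The
   remaining ages exceed every possible sojourn time. *)
Definition state_space : set (X * R) :=
  [set z | 0 <= z.2 /\ G z.1 z.2 < 1].

Definition age_derivable (f : X * R -> R) (z : X * R) : Prop :=
  cvg (diff_quotient (fun t => f (z.1, t)) z.2 h @[h --> incr_filter z.2]).

Definition age_derivative (f : X * R -> R) (z : X * R) : R :=
  lim (diff_quotient (fun t => f (z.1, t)) z.2 h @[h --> incr_filter z.2]).

Definition generatorQ (f : X * R -> R) (z : X * R) : R :=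
  age_derivative f z
  + g z.1 z.2 / (1 - G z.1 z.2) * (\int[P z.1]_y (f (y, 0) - f z))%R.

Definition test_function (f : X * R -> R) : Prop :=
  [/\ measurable_fun setT f,
      exists M : R, forall z, state_space z -> `|f z| <= M
    & forall x, {within [set t | state_space (x, t)],
                   continuous (fun t => f (x, t))}].

End SemiMarkovKernel.

Section Semigroups.
Context {d : measure_display} {X : measurableType d} {R : realType}.
Implicit Types (p : R -> R.-pker (X * R)%type ~> (X * R)%type).

(* The operator at time t of the semigroup with transition kernels p.  It is
   only used for t >= 0. *)
Definition semigroup_op p (t : R) (f : X * R -> R) (z : X * R) : R :=
  (\int[p t z]_y f y)%R.

Record transition_semigroup (D : set (X * R)) p : Prop := {
  transition_conservative : forall t z, 0 <= t -> D z -> p t z D = 1%E;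
  transition0 : forall z (B : set (X * R)), D z -> measurable B ->
    p 0 z B = \d_z B;
  chapman_kolmogorov : forall s t z (B : set (X * R)),
    0 <= s -> 0 <= t -> D z -> measurable B ->
    p (s + t) z B = (\int[p s z]_y p t y B)%E }.

(* l is the limit of (T_h f - f) / h as h -> 0+, in the sense of bounded
   pointwise convergence on D (Dynkin's weak infinitesimal generator). *)
Definition weak_generator (D : set (X * R)) p (f l : X * R -> R) : Prop :=
  (exists M : R, forall h z, 0 < h -> D z ->
     `|(semigroup_op p h f z - f z) / h| <= M) /\
  (forall z, D z -> (semigroup_op p h f z - f z) / h @[h --> 0^'+] --> l z).

(* p is the semigroup e^{tQ}: a semigroup of probability kernels on the state
   space, acting on the bounded measurable functions that are continuous in
   the age and pointwise continuous at time 0 there, whose infinitesimal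
   generator is Q with domain the f that are differentiable in the age and
   have Q f in the same class.  Norm-strong continuity would be too
   restrictive: it fails already for unbounded hazard rates. *)
Record generated_by (P : R.-pker X ~> X) (G g : X -> R -> R) p : Prop := {
  generated_semigroup : transition_semigroup (state_space G) p;
  generated_stable : forall t f, 0 <= t ->
    test_function G f -> test_function G (semigroup_op p t f);
  generated_continuous : forall f z, test_function G f -> state_space G z ->
    semigroup_op p h f z @[h --> 0^'+] --> f z;
  generated_generator : forall f l, test_function G f -> test_function G l ->
    weak_generator (state_space G) p f l <->
    (forall z, state_space G z ->
       age_derivable f z /\ l z = generatorQ P G g f z) }.

End Semigroups.

Section Processes.
Context {d dO : measure_display} {X : measurableType d}
        {Om : measurableType dO} {R : realType}.
Variable Pr : probability Om R.

Section Renewal.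
Variables (xi : nat -> {mfun Om >-> X}) (tau : nat -> {RV Pr >-> R}).

Definition renewal_filtration (n : nat) : set (set Om) :=
  <<s [set A | exists k : nat, (k <= n)%N /\
        ((exists2 B : set X, measurable B & A = xi k @^-1` B) \/
         (exists2 B : set R, measurable B & A = tau k @^-1` B))] >>.

(* The conditional probability given F_n is characterized by its integrals
   over the events of F_n. *)
Definition markov_renewal (P : R.-pker X ~> X) (G : X -> R -> R) : Prop :=
  forall n (A : set Om) (B : set X) (t : R),
    renewal_filtration n A -> measurable B -> 0 <= t ->
    Pr (A `&` [set w | B (xi n.+1 w) /\ tau n.+1 w - tau n w <= t]) =
    (\int[Pr]_(w in A) semi_markov_kernel P G (xi n w) B t)%E.

(* sup {n | tau_n <= t}, as the greatest element of this set of naturals; the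
   default 0 is only used when the supremum is not attained, i.e. when
   infinitely many jumps (or none) occurred up to time t. *)
Definition jump_count (t : R) (w : Om) : nat :=
  xget 0%N [set n | tau n w <= t /\ forall m, tau m w <= t -> (m <= n)%N].

Definition non_explosive : Prop :=
  {ae Pr, forall w, forall t : R, exists n, t < tau n w}.

Definition semi_markov (t : R) (w : Om) : X := xi (jump_count t w) w.

Definition backward_recurrence (t : R) (w : Om) : R :=
  t - tau (jump_count t w) w.

Definition sm_pair (t : R) (w : Om) : X * R :=
  (semi_markov t w, backward_recurrence t w).

End Renewal.

Section MarkovProperty.
Variable Z : R -> Om -> X * R.

Definition natural_filtration (t : R) : set (set Om) :=
  <<s [set A | exists2 s : R, 0 <= s <= t &
        exists2 B : set (X * R), measurable B & A = Z s @^-1` B] >>.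

Definition markov_with_transition
    (p : R -> R.-pker (X * R)%type ~> (X * R)%type) : Prop :=
  forall s t (A : set Om) (B : set (X * R)), 0 <= s -> 0 <= t ->
    natural_filtration t A -> measurable B ->
    Pr (A `&` Z (t + s) @^-1` B) = (\int[Pr]_(w in A) p s (Z t w) B)%E.

Definition markov_with_generator
    (P : R.-pker X ~> X) (G g : X -> R -> R) : Prop :=
  exists2 p, generated_by P G g p & markov_with_transition p.

Definition realized_var (T : R) (s : X * R -> R) (w : Om) : R :=
  T^-1 * (\int[lebesgue_measure]_(t in `[0, T]) (s (Z t w)) ^+ 2)%R.

Definition realized_cov (T : R) (rho : R -> R) (s1 s2 : X * R -> R) (w : Om) : R :=
  T^-1 * (\int[lebesgue_measure]_(t in `[0, T])
            (rho t * s1 (Z t w) * s2 (Z t w)))%R.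

End MarkovProperty.

(* Correlation coefficient with covariance c and variances v1, v2.  The
   realized correlation is corr_coef of the realized covariance and variances;
   its zero-order approximation replaces the variances by their means. *)
Definition corr_coef (c v1 v2 : R) : R := c / (Num.sqrt v1 * Num.sqrt v2).

(* Value of a swap, of unit notional, of the correlation C against K. *)
Definition corr_swap_value (r T K : R) (C : Om -> R) : \bar R :=
  'E_Pr[fun w => expR (- r * T) * (C w - K)].

End Processes.

(* Main.v *)
Require Import Defs.
From HB Require Import structures.
From mathcomp Require Import all_boot all_order all_algebra.
From mathcomp Require Import all_classical all_reals all_analysis.
From mathcomp Require Import measurable_realfun.
From mathcomp Require Import ring lra.
Import Order.TTheory GRing.Theory Num.Theory.
Import numFieldNormedType.Exports.
Local Open Scope classical_set_scope.
Local Open Scope ring_scope.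

(** By Fubini everything reduces to [E s(x_t, gamma(t)) = (e^{tQ} s)(x, 0)].
    The Markov property at time 0 gives the law of [(x_t, gamma(t))] as the
    transition kernel [p_t((x, 0), .)] of some semigroup [p] generated by [Q], so
    the point is that [Q] determines its semigroup.  For a test function [f], the
    resolvent [V f = int_0^oo l e^{-lt} p_t f dt] is a test function in the domain
    of the generator of [p], with [Q (V f) = l (V f - f)].  If [q] is another
    semigroup generated by [Q], then [V f] lies in the domain of its generator as
    well, and averaging [q_t Q (V f)] over an exponential time shows that [V f] is
    also the resolvent of [q] at [f].  Hence [t |-> p_t f (z)] and
    [t |-> q_t f (z)] have the same Laplace transform; they are bounded and
    right-continuous, so they coincide, and test functions determine the
    transition probabilities. *)

Set Implicit Arguments.
Unset Strict Implicit.
Unset Printing Implicit Defensive.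

(** * Integration preliminaries *)

(** For a general test function the path [t |-> p_t f (z)] is only known to be right-continuous, and
    the generator is only a bounded pointwise limit, so neither a differential equation in [t] nor
    norm estimates are at hand. Exponential averages replace both: memorylessness turns a time shift
    by [h] into a factor [e^{-lh}] and a window [[0, h[] of mass [1 - e^{-lh}], which yields a right
    derivative at [h = 0] from right continuity alone, and bounded pointwise limits pass through by
    dominated convergence. The passage from [p] to [q] is possible because [generated_generator] is
    an equivalence whose right-hand side mentions no semigroup: it is read forwards for [p] and
    backwards for [q]. Real-valued integrals are 0 when the underlying one is infinite; identities
    needed at every time have to survive this convention, since Fubini gives integrability at almost
    every time only. *)

Lemma Rintegral_dominated_cvg {d} {T : measurableType d} {R : realType}
    (mu : {measure set T -> \bar R}) (f_ : nat -> T -> R) (f h : T -> R) :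
    (forall n, measurable_fun setT (f_ n)) ->
    (forall x, f_ ^~ x @ \oo --> f x) ->
    mu.-integrable setT (EFin \o h) ->
    (forall n x, `|f_ n x| <= h x) ->
  (\int[mu]_x f_ n x)%R @[n --> \oo] --> (\int[mu]_x f x)%R.
Proof.
move=> mf_ cf_ ih f_h.
have mf : measurable_fun setT f by exact: measurable_fun_cvg (fun x _ => cf_ x).
have [intf _ cvgf] : [/\ mu.-integrable setT (EFin \o f),
   [sequence \int[mu]_x `|(f_ n x)%:E - (f x)%:E|]_n @ \oo --> 0%E &
   [sequence \int[mu]_x (f_ n x)%:E]_n @ \oo --> \int[mu]_x (f x)%:E]%E.
  apply: (@dominated_convergence _ _ _ mu setT _ (fun n x => (f_ n x)%:E)
    (EFin \o f) (EFin \o h)) => //.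
  - by move=> n; exact/measurable_EFinP.
  - exact/measurable_EFinP.
  - by apply: aeW => x _; apply: cvg_EFin; [exact: nearW | exact: cf_].
  - by apply: aeW => x n _ /=; rewrite lee_fin.
apply: fine_cvg; rewrite fineK //.
exact: integrable_fin_num.
Qed.

Lemma integrable_dominated {d} {T : measurableType d} {R : realType}
    (mu : {measure set T -> \bar R}) (f h : T -> R) :
    measurable_fun setT f -> mu.-integrable setT (EFin \o h) ->
    (forall x, `|f x| <= h x) ->
  mu.-integrable setT (EFin \o f).
Proof.
move=> mf ih fh; apply: le_integrable ih => //; first exact/measurable_EFinP.
by move=> x _ /=; rewrite lee_fin (le_trans (fh x))// ler_norm.
Qed.

Lemma integrable_bounded {d} {T : measurableType d} {R : realType}
    (mu : {measure set T -> \bar R}) (f : T -> R) (M : R) :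
    (mu setT < +oo)%E -> measurable_fun setT f -> (forall x, `|f x| <= M) ->
  mu.-integrable setT (EFin \o f).
Proof.
move=> muT mf fM; apply: (@integrable_dominated _ _ _ _ _ (cst M)) => //.
apply/integrableP; split; first exact/measurable_EFinP.
by rewrite (eq_integral (cst `|M|%:E))// integral_cst// lte_mul_pinfty.
Qed.

Lemma le_norm_Rintegral {d} {T : measurableType d} {R : realType}
    (mu : {measure set T -> \bar R}) (f h : T -> R) :
    measurable_fun setT f -> mu.-integrable setT (EFin \o h) ->
    (forall x, `|f x| <= h x) ->
  `|(\int[mu]_x f x)%R| <= (\int[mu]_x h x)%R.
Proof.
move=> mf ih fh; have intf := integrable_dominated mf ih fh.
apply: (le_trans (le_normr_Rintegral measurableT intf)).
apply: le_Rintegral => //.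
by have := integrable_norm intf; apply: eq_integrable.
Qed.

(** Rounding [t] up to a grid of mesh [1/(n+1)] leaves countably many sections, so preimages under
    the rounded function are countable unions of rectangles; right continuity recovers [u] in the
    limit. *)
Lemma measurable_right_continuous {d} {T : measurableType d} {R : realType}
    (u : R -> T -> R) :
    (forall t, measurable_fun setT (u t)) ->
    (forall t z, u s z @[s --> t^'+] --> u t z) ->
  measurable_fun setT (fun tz : R * T => u tz.1 tz.2).
Proof.
move=> mu_ cu.
(* The [+ 1] keeps the grid point strictly to the right of [t], even for [t] on the grid, as a limit
   along [t^'+] requires. *)
pose a n (t : R) : R := (Num.floor (t * n.+1%:R) + 1)%:~R / n.+1%:R.
have a_gt n t : t < a n t.
  by rewrite /a ltr_pdivlMr ?ltr0n// floorD1_gt.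
have a_le n t : a n t <= t + n.+1%:R^-1.
  rewrite /a ler_pdivrMr ?ltr0n// mulrDl mulVf ?pnatr_eq0// intrD lerD2r.
  exact: floor_le.
have a_cvg t : a n t @[n --> \oo] --> t.
  apply: (@squeeze_cvgr _ _ _ _ (cst t) (fun n => t + n.+1%:R^-1)).
  - by apply: nearW => n; rewrite (ltW (a_gt _ _)) a_le.
  - exact: cvg_cst.
  - rewrite -[X in _ --> X]addr0; apply: cvgD; first exact: cvg_cst.
    exact: cvg_harmonic.
apply: (@measurable_fun_cvg _ _ _ _ (fun n tz => u (a n tz.1) tz.2)); last first.
  move=> [t z] _ /=; have /cvg_at_rightP := cu t z; apply.
  by split=> [n|]; [exact: a_gt | exact: a_cvg].
move=> n _ B mB; rewrite setTI.
have -> : (fun tz : R * T => u (a n tz.1) tz.2) @^-1` B =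
   \bigcup_(k : int) ([set t : R | Num.floor (t * n.+1%:R) = k] `*`
                      (u ((k + 1)%:~R / n.+1%:R) @^-1` B)).
  apply/seteqP; split=> [[t z] /= Btz|[t z] [k _ [/= tk]]].
    by exists (Num.floor (t * n.+1%:R)).
  by rewrite /a tk.
apply: countable_bigcupT_measurable => // k.
apply: measurableX.
  rewrite (_ : [set _ | _] = `[k%:~R / n.+1%:R, (k + 1)%:~R / n.+1%:R[%classic).
    exact: measurable_itv.
  apply/seteqP; split => t /=; rewrite in_itv/= ler_pdivrMr ?ltr0n//.
    rewrite ltr_pdivlMr ?ltr0n// => <-.
    by rewrite floor_le floorD1_gt.
  by rewrite ltr_pdivlMr ?ltr0n// => h; apply: floor_def.
by rewrite -[X in measurable X]setTI; exact: mu_.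
Qed.

Lemma lebesgue_measure_shift {R : realType} (h : R) (A : set R) :
  measurable A ->
  lebesgue_measure A = lebesgue_measure ((fun t => t + h) @^-1` A).
Proof.
move=> mA.
have mh : measurable_fun [set: measurableTypeR R]
    ((fun t => t + h) : measurableTypeR R -> measurableTypeR R).
  exact: (@measurable_funD _ R R).
pose m0 := [the measure _ _ of pushforward (@lebesgue_measure R)
  ((fun t => t + h) : measurableTypeR R -> measurableTypeR R)].
pose m : {measure set (measurableTypeR R) -> \bar R} := m0 mh.
rewrite (@lebesgue_measure_unique R m) // => _ [[a b]] _ <-.
rewrite /m/= /pushforward (_ : _ @^-1` _ = `]a - h, b - h]%classic); last first.
  by apply/seteqP; split=> t /=; rewrite !in_itv/= ltrBlDr lerBrDr.
rewrite !lebesgue_measure_itv/= !lte_fin ltrD2r.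
by case: ifP => // _; rewrite -!EFinB; congr EFin; ring.
Qed.

Lemma Rintegral_shift {R : realType} (h : R) (f : R -> R) :
    measurable_fun setT f ->
    (@lebesgue_measure R).-integrable setT (EFin \o f) ->
  (\int[lebesgue_measure]_t f (t + h))%R = (\int[lebesgue_measure]_t f t)%R.
Proof.
move=> mf /integrableP[_ intf]; rewrite /Rintegral; congr fine.
have mh : measurable_fun [set: measurableTypeR R]
    ((fun t => t + h) : measurableTypeR R -> measurableTypeR R).
  exact: (@measurable_funD _ R R).
pose m0 := [the measure _ _ of pushforward (@lebesgue_measure R)
  ((fun t => t + h) : measurableTypeR R -> measurableTypeR R)].
pose m : {measure set (measurableTypeR R) -> \bar R} := m0 mh.
have mE g : (\int[m]_t g t = \int[lebesgue_measure]_t g t)%E.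
  by apply: eq_measure_integral => A mA _; rewrite [RHS](lebesgue_measure_shift h).
have mf' : measurable_fun [set: measurableTypeR R] (EFin \o f).
  exact/measurable_EFinP.
rewrite -[RHS]mE integral_pushforward// preimage_setT.
apply/integrableP; split; first exact: measurableT_comp.
move: intf; rewrite -mE ge0_integral_pushforward//.
exact: measurableT_comp.
Qed.

(** * Averages over exponential times and uniqueness of Laplace transforms *)

Section ExponentialAverage.
Context {R : realType}.
Implicit Types (l h M e t : R) (u v : R -> R).

(** [l] times the Laplace transform of [u] at [l]. The weight is a probability density, so bounds
    are preserved, and it ignores negative times. *)
Definition exp_average l u : R :=
  (\int[lebesgue_measure]_t (exponential_pdf l t * u t))%R.

(** Memorylessness of the exponential law. The part after [h] is written as the whole minus the
    early part, because the latter is estimated on its own. *)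
Lemma exponential_pdf_shift l h t : 0 <= h ->
  expR (- l * h) * exponential_pdf l (t - h) =
  exponential_pdf l t - exponential_pdf l t * \1_(`]-oo, h[%classic) t.
Proof.
move=> h0; rewrite indicE mem_setE in_itv/=; have [th|ht] := ltP t h.
  by rewrite lt0_exponential_pdf ?subr_lt0// mulr1 subrr mulr0.
rewrite mulr0 subr0.
rewrite !exponential_pdfE ?subr_ge0//; last exact: le_trans ht.
by rewrite mulrCA -expRD; congr (_ * expR _); ring.
Qed.

Lemma integrable_exp_weight l M u : 0 < l -> measurable_fun setT u ->
    (forall t, `|u t| <= M) ->
  (@lebesgue_measure R).-integrable setT
    (EFin \o (fun t => exponential_pdf l t * u t)).
Proof.
move=> l0 mu_ uM.
apply: (@integrable_dominated _ (measurableTypeR R) R lebesgue_measure _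
  (fun t => exponential_pdf l t * M)).
- by apply: measurable_funM => //; exact: measurable_exponential_pdf.
- have := integrableZl measurableT M (integrable_exponential_pdf l0).
  by apply: eq_integrable => // t _ /=; rewrite -EFinM mulrC.
- move=> t; have k0 := exponential_pdf_ge0 (ltW l0) t.
  by rewrite normrM (ger0_norm k0) ler_wpM2l.
Qed.

Lemma exp_average_cst l M : 0 < l -> exp_average l (cst M) = M.
Proof.
move=> l0; rewrite /exp_average RintegralZr//.
  by rewrite /Rintegral integral_exponential_pdf// mul1r.
exact: integrable_exponential_pdf.
Qed.

Lemma le_norm_exp_average l M u : 0 < l -> measurable_fun setT u ->
  (forall t, `|u t| <= M) -> `|exp_average l u| <= M.
Proof.
move=> l0 mu_ uM; rewrite -[leRHS](exp_average_cst M l0).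
apply: le_norm_Rintegral.
- by apply: measurable_funM => //; exact: measurable_exponential_pdf.
- apply: (integrable_exp_weight l0 _ (M := `|M|)) => //.
- move=> t /=; have k0 := exponential_pdf_ge0 (ltW l0) t.
  by rewrite normrM (ger0_norm k0) ler_wpM2l.
Qed.

Lemma exp_averageB l M u v : 0 < l ->
    measurable_fun setT u -> measurable_fun setT v ->
    (forall t, `|u t| <= M) -> (forall t, `|v t| <= M) ->
  exp_average l (fun t => u t - v t) = exp_average l u - exp_average l v.
Proof.
move=> l0 mu_ mv uM vM; rewrite /exp_average -RintegralB//.
- by apply: eq_Rintegral => t _; rewrite mulrBr.
- exact: integrable_exp_weight mu_ uM.
- exact: integrable_exp_weight mv vM.
Qed.

Lemma exp_averageZ l M k u : 0 < l -> measurable_fun setT u ->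
    (forall t, `|u t| <= M) ->
  exp_average l (fun t => k * u t) = k * exp_average l u.
Proof.
move=> l0 mu_ uM; rewrite /exp_average -RintegralZl//.
- by apply: eq_Rintegral => t _; rewrite mulrCA.
- exact: integrable_exp_weight mu_ uM.
Qed.

(** Translation invariance moves the shift from [u] to the density, where memorylessness applies. *)
Lemma exp_average_shift l h M u : 0 < l -> 0 <= h -> measurable_fun setT u ->
    (forall t, `|u t| <= M) ->
  expR (- l * h) * exp_average l (fun t => u (t + h)) =
  exp_average l u - exp_average l (fun t => u t * \1_(`]-oo, h[%classic) t).
Proof.
move=> l0 h0 mu_ uM.
have mi : measurable_fun setT (fun t => u t * \1_(`]-oo, h[%classic) t).
  exact: measurable_funM.
have iM t : `|u t * \1_(`]-oo, h[%classic) t| <= M.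
  rewrite normrM indicE; case: (_ \in _); rewrite ?normr1 ?normr0 ?mulr1 ?mulr0//.
  exact: le_trans (uM t).
rewrite -(exp_averageB l0 mu_ mi uM iM).
rewrite -(exp_averageZ _ (M := M)) //; last first.
  by apply: measurableT_comp => //; exact: measurable_funD.
rewrite /exp_average -[RHS](Rintegral_shift h).
- apply: eq_Rintegral => t _.
  rewrite mulrCA mulrA -[X in exponential_pdf l X](addrK h t).
  rewrite exponential_pdf_shift//; ring.
- by apply: measurable_funM; [exact: measurable_exponential_pdf|exact: measurable_funB].
- apply: (integrable_exp_weight l0 (M := M + M)) => [|t].
    exact: measurable_funB.
  by rewrite (le_trans (ler_normB _ _))// lerD.
Qed.

Lemma exp_average_itv l h : 0 < l -> 0 < h ->
  exp_average l (\1_(`]-oo, h[%classic)) = 1 - expR (- l * h).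
Proof.
move=> l0 h0.
have := @exp_average_shift l h 1 (cst 1) l0 (ltW h0) (measurable_cst _).
rewrite !exp_average_cst// mulr1 => -> => [|t /=]; last by rewrite normr1.
rewrite opprB addrCA subrr addr0; congr exp_average.
by apply/funext => t; rewrite mul1r.
Qed.

End ExponentialAverage.

Lemma le_norm_exp_average_early {R : realType} (l h e M : R) (v : R -> R) :
    0 < l -> 0 < h -> measurable_fun setT v -> (forall t, `|v t| <= M) ->
    (forall t, 0 <= t < h -> `|v t| <= e) ->
  `|exp_average l (fun t => v t * \1_(`]-oo, h[%classic) t)|
    <= (1 - expR (- l * h)) * e.
Proof.
move=> l0 h0 mv vM ve; rewrite -exp_average_itv//.
have iM (t : R) : `|\1_(`]-oo, h[%classic) t : R| <= 1.
  by rewrite indicE; case: (_ \in _); rewrite ?normr1 ?normr0.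
have mi : measurable_fun setT (\1_(`]-oo, h[%classic) : R -> R) by [].
rewrite mulrC -(exp_averageZ e l0 mi iM).
apply: le_norm_Rintegral.
- apply: measurable_funM; first exact: measurable_exponential_pdf.
  exact: measurable_funM.
- apply: (integrable_exp_weight l0 (M := `|e|)); first exact: measurable_funM.
  by move=> t; rewrite normrM -[leRHS]mulr1; exact: ler_pM.
- move=> t; have k0 := exponential_pdf_ge0 (ltW l0) t.
  have [t0|t0] := ltP t 0; first by rewrite lt0_exponential_pdf// !mul0r normr0.
  rewrite normrM (ger0_norm k0) ler_wpM2l// normrM.
  rewrite indicE mem_setE in_itv/=; have [th|] := ltP t h; last first.
    by rewrite normr0 !mulr0.
  by rewrite normr1 !mulr1 ve// t0 th.
Qed.

(** * First-order expansion in [h] of the average of [u (t + h)] *)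

Section ExponentialAverageIncrement.
Context {R : realType}.
Variables (l M : R) (u : R -> R).
Hypotheses (l0 : 0 < l) (mu_ : measurable_fun setT u)
  (uM : forall t, `|u t| <= M).

Let M0 : 0 <= M. Proof. exact: le_trans (uM 0). Qed.

Let mushift (h : R) : measurable_fun setT (fun t : R => u (t + h)).
Proof. by apply: measurableT_comp => //; exact: measurable_funD. Qed.

Let early (h t : R) : R := u t * \1_(`]-oo, h[%classic) t.

Let expR1 (h : R) : 0 < h -> 0 <= 1 - expR (- l * h) <= l * h.
Proof.
move=> h0; have h1 := expR_ge1Dx (- l * h).
apply/andP; split; last by move: h1; rewrite mulNr; lra.
by rewrite subr_ge0 -expR0 ler_expR mulNr oppr_le0 mulr_ge0 ?ltW.
Qed.

Let incrE (h : R) : 0 < h ->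
  exp_average l (fun t => u (t + h)) - exp_average l u =
  (1 - expR (- l * h)) * exp_average l (fun t => u (t + h))
  - exp_average l (early h).
Proof.
by move=> h0; rewrite mulrBl mul1r (exp_average_shift l0 (ltW h0) mu_ uM); ring.
Qed.

(** Both terms of [incrE] are at most [M * l * h], since the early window has mass at most [l * h].
    This is the uniform bound on difference quotients that [weak_generator] demands. *)
Lemma exp_average_incr_le (h : R) : 0 < h ->
  `|exp_average l (fun t => u (t + h)) - exp_average l u| <= 2 * M * l * h.
Proof.
move=> h0; rewrite incrE//; have /andP[th0 th1] := expR1 h0.
have A1 : `|exp_average l (fun t => u (t + h))| <= M.
  exact: le_norm_exp_average.
have B1 : `|exp_average l (early h)| <= M * (l * h).
  have := @le_norm_exp_average_early _ l h M M u l0 h0 mu_ uM (fun t _ => uM t).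
  by move/le_trans; apply; rewrite mulrC ler_wpM2l.
rewrite (le_trans (ler_normB _ _))// normrM (ger0_norm th0).
have : (1 - expR (- l * h)) * `|exp_average l (fun t => u (t + h))| <=
  (l * h) * M by apply: ler_pM.
lra.
Qed.

(** Quantitative form of the right derivative at [h = 0]. The oscillation of [u] on the window costs
    [l * e]; two second-order errors, at most [2 * M * (l * h)^2] each, give the constant 4 after
    division by [h]. *)
Lemma exp_average_incr_close (h e : R) : 0 < h ->
    (forall t, 0 <= t < h -> `|u t - u 0| <= e) ->
  `|(exp_average l (fun t => u (t + h)) - exp_average l u) / h
     - l * (exp_average l u - u 0)| <= 4 * M * l ^+ 2 * h + l * e.
Proof.
move=> h0 ue; have /andP[th0 th1] := expR1 h0.
have e0 : 0 <= e by apply: (le_trans _ (ue 0 _)) => //; rewrite lexx.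
set A := exp_average l (fun t => u (t + h)); set I := exp_average l u.
have AI : `|A - I| <= 2 * M * l * h by exact: exp_average_incr_le.
have JE : `|exp_average l (early h) - (1 - expR (- l * h)) * u 0|
    <= (1 - expR (- l * h)) * e.
  have iM (t : R) : `|\1_(`]-oo, h[%classic) t : R| <= 1.
    by rewrite indicE; case: (_ \in _); rewrite ?normr1 ?normr0.
  have mi : measurable_fun setT (\1_(`]-oo, h[%classic) : R -> R) by [].
  rewrite -[in X in _ - X]exp_average_itv// mulrC -(exp_averageZ (u 0) l0 mi iM).
  rewrite -(@exp_averageB _ l M)//; last 4 first.
  - exact: measurable_funM.
  - exact: measurable_funM.
  - by move=> t; rewrite normrM -[leRHS]mulr1; exact: ler_pM.
  - by move=> t; rewrite normrM -[leRHS]mulr1; exact: ler_pM.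
  rewrite (_ : (fun t => _) = fun t => (u t - u 0) * \1_(`]-oo, h[%classic) t).
    apply: (le_norm_exp_average_early (M := M + M)) => //.
      exact: measurable_funB.
    by move=> t; rewrite (le_trans (ler_normB _ _))// lerD.
  by apply/funext => t; rewrite mulrBl.
have AE := incrE h0; rewrite -/A -/I in AE.
set J := exp_average l (early h) in JE AE.
set th := 1 - expR (- l * h) in th0 th1 JE AE.
have I1 : `|I| <= M by exact: le_norm_exp_average.
(* The errors come from replacing the shifted average by [I], the window mass [th] by [l * h], and
   [u] by [u 0] on the window. *)
have -> : (A - I) / h - l * (I - u 0) =
   ((th * (A - I)) - (l * h - th) * (I - u 0) - (J - th * u 0)) / h.
  apply: (mulIf (lt0r_neq0 h0)); rewrite mulrBl !divfK ?gt_eqF// [X in X - _]AE; ring.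
rewrite normrM [X in _ * X]ger0_norm ?invr_ge0 ?(ltW h0)// ler_pdivrMr//.
(* With [x = l h] and [y = e^{-x}]: [y (1 + x) <= 1 <= 1 + x^3 = (1 + x) (1 - x + x^2)]. *)
have th2 : l * h - th <= (l * h) ^+ 2.
  have x0 : 0 < l * h by exact: mulr_gt0.
  have : expR (- l * h) * (1 + l * h) <= 1.
    rewrite -[leRHS](expRxMexpNx_1 (l * h)) mulNr mulrC.
    by rewrite ler_pM2r ?expR_gt0// expR_ge1Dx.
  rewrite /th; move: (expR (- l * h)) => y hy.
  have : y <= 1 - l * h + (l * h) ^+ 2; last by lra.
  rewrite -(ler_pM2r (x := 1 + l * h)); last lra.
  apply: (le_trans hy); have := exprn_ge0 3 (ltW x0); lra.
have lhth : 0 <= l * h - th by rewrite subr_ge0.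
have Iu : `|I - u 0| <= 2 * M.
  by rewrite (le_trans (ler_normB _ _))// mulr2n mulrDl mul1r lerD.
rewrite (le_trans (ler_normB _ _))//.
have := ler_normB (th * (A - I)) ((l * h - th) * (I - u 0)).
rewrite !normrM (ger0_norm th0) (ger0_norm lhth) => H1.
have H2 : th * `|A - I| <= l * h * (2 * M * l * h) by exact: ler_pM.
have H3 : (l * h - th) * `|I - u 0| <= (l * h) ^+ 2 * (2 * M) by exact: ler_pM.
have H4 : th * e <= l * h * e by rewrite ler_wpM2r.
have -> : (4 * M * l ^+ 2 * h + l * e) * h =
   l * h * (2 * M * l * h) + (l * h) ^+ 2 * (2 * M) + l * h * e by ring.
lra.
Qed.

End ExponentialAverageIncrement.

(** * Injectivity of the Laplace transform at points of right continuity *)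

Section LaplaceBump.
Context {R : realType}.
Variables (M : R) (u : R -> R).
Hypotheses (mu_ : measurable_fun setT u) (uM : forall t, `|u t| <= M)
  (u_orth : forall l : R, 0 < l -> exp_average l u = 0).

Let M0 : 0 <= M. Proof. exact: le_trans (uM 0). Qed.

Variables a b : R.
Hypotheses (a01 : 0 <= a <= 1) (b01 : 0 <= b <= 1).

(* As a polynomial in [x = e^{-t}], [q] exceeds 1 for [x] in ]a, b[ and stays in
   [0, 1] on the rest of [0, 1], so its powers concentrate on the times [t] with
   [e^{-t}] in ]a, b[. *)
Let x (t : R) : R := expR (- `|t|).
Let q (t : R) : R := 1 - (x t - a) * (x t - b).

Let mx : measurable_fun setT x.
Proof.
apply: measurableT_comp; first exact: measurable_expR.
by apply: measurableT_comp => //; exact: measurable_normr.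
Qed.

Let mq : measurable_fun setT q.
Proof.
apply: measurable_funB => //.
by apply: measurable_funM; exact: measurable_funB.
Qed.

Let x01 t : 0 <= x t <= 1.
Proof. by rewrite expR_ge0 -expR0 ler_expR oppr_le0 normr_ge0. Qed.

Let q02 t : `|q t| <= 2.
Proof.
have := x01 t; rewrite ler_norml /q; move: (x t) => y.
case/andP: a01 => a0 a1; case/andP: b01 => b0 b1 /andP[y0 y1].
by apply/andP; split; nra.
Qed.

Lemma bump_bounded m i :
  measurable_fun setT (fun t => x t ^+ i * q t ^+ m * u t) /\
  forall t, `|x t ^+ i * q t ^+ m * u t| <= 2 ^+ m * M.
Proof.
split.
  apply: measurable_funM => //; apply: measurable_funM.
    exact: measurable_funX.
  exact: measurable_funX.
move=> t; rewrite !normrM ler_pM// !normrX -[leRHS]mul1r ler_pM ?exprn_ge0//.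
  have /andP[x0 x1] := x01 t.
  by rewrite ger0_norm// exprn_ile1.
by rewrite lerXn2r ?nnegrE.
Qed.

(** Since [e^{-t} x^j] is, for [t >= 0], the density of rate [j + 1] divided by [j + 1], the case
    [n = 0] is the hypothesis at integer rates. Each factor [q] is quadratic in [x] and raises [j]
    by at most 2, so the induction on [n] runs over all [j]. *)
Lemma exp_average1_bump n j :
  exp_average 1 (fun t => x t ^+ j * q t ^+ n * u t) = 0.
Proof.
elim: n j => [|n IHn] j.
  have j0 : 0 < j.+1%:R :> R by rewrite ltr0n.
  have := u_orth j0; rewrite /exp_average => uj.
  rewrite (_ : (fun t => _) =
      fun t => j.+1%:R^-1 * (exponential_pdf j.+1%:R t * u t)); last first.
    apply/funext => t; rewrite expr0 mulr1.
    have [t0|t0] := ltP t 0; first by rewrite !lt0_exponential_pdf// !mul0r mulr0.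
    rewrite !exponential_pdfE//= mul1r !mulrA mulVf ?gt_eqF// mul1r.
    congr (_ * _); rewrite /x ger0_norm// -expRM_natl -expRD; congr expR.
    by rewrite -addn1 natrD; ring.
  rewrite RintegralZl ?uj ?mulr0//.
  exact: integrable_exp_weight uM.
have [m0 b0] := bump_bounded n j; have [m1 b1] := bump_bounded n j.+1.
have [m2 b2] := bump_bounded n j.+2.
(* Expansion [q = (1 - a b) + (a + b) x - x^2], arranged as differences to suit [exp_averageB]. *)
rewrite (_ : (fun t => _) = fun t =>
   ((1 - a * b) * (x t ^+ j * q t ^+ n * u t) -
    (- (a + b)) * (x t ^+ j.+1 * q t ^+ n * u t)) -
     x t ^+ j.+2 * q t ^+ n * u t); last first.
  apply/funext => t; rewrite !exprSr {2}/q; ring.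
pose C := (`|1 - a * b| + `|- (a + b)|) * (2 ^+ n * M) + 2 ^+ n * M.
have C0 : 0 <= 2 ^+ n * M by rewrite mulr_ge0// exprn_ge0.
have [na nb] := (normr_ge0 (1 - a * b), normr_ge0 (- (a + b))).
have Z k i : measurable_fun setT (fun t => k * (x t ^+ i * q t ^+ n * u t)).
  by apply: measurable_funM => //; have [] := bump_bounded n i.
have ZM k i t : `|k * (x t ^+ i * q t ^+ n * u t)| <= `|k| * (2 ^+ n * M).
  by rewrite normrM ler_wpM2l//; have [_] := bump_bounded n i; apply.
rewrite (@exp_averageB _ 1 C)//; first last.
- by move=> t; rewrite (le_trans (b2 t))// /C lerDr mulr_ge0// addr_ge0.
- move=> t; rewrite (le_trans (ler_normB _ _))//.
  rewrite (le_trans (lerD (ZM _ _ _) (ZM _ _ _)))//.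
  by rewrite -mulrDl /C lerDl.
- exact: measurable_funB.
rewrite (@exp_averageB _ 1 C)//; first last.
- move=> t; rewrite (le_trans (ZM _ _ _))// /C mulrDl -addrA addrCA lerDl.
  by rewrite addr_ge0// mulr_ge0.
- move=> t; rewrite (le_trans (ZM _ _ _))// /C mulrDl -addrA lerDl.
  by rewrite addr_ge0// mulr_ge0.
rewrite !(@exp_averageZ _ 1 (2 ^+ n * M))//.
by rewrite !IHn !mulr0 !subr0.
Qed.

End LaplaceBump.

(** If [u t0 > 0], then [u] exceeds some [c > 0] just to the right of [t0]. Powers of the bump grow
    at least like [n * eta] on an inner interval, are nonnegative around it and at most 1 in
    absolute value elsewhere, so the integral, which is 0, would be at least a positive multiple of
    [n] minus [M]. *)
Lemma exp_average_inj_le0 {R : realType} (M : R) (u : R -> R) (t0 : R) :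
    measurable_fun setT u -> (forall t, `|u t| <= M) ->
    u s @[s --> t0^'+] --> u t0 ->
    (forall l : R, 0 < l -> exp_average l u = 0) ->
  0 <= t0 -> u t0 <= 0.
Proof.
move=> mu_ uM cu u0 t00; rewrite leNgt; apply/negP => ut0.
have M0 : 0 <= M by exact: le_trans (uM 0).
pose c := u t0 / 2.
have c0 : 0 < c by rewrite divr_gt0.
have [d /= d0 ud] : \forall s \near t0^'+, c < u s.
  by apply: (cvgr_gt (u t0)) => //; rewrite /c; lra.
(* [[t0, t3]] lies where [u > c]; the gaps between [t0] and [t1] and between [t2] and [t3] make
   [eta] positive. *)
pose t1 := t0 + d / 4; pose t2 := t0 + d / 2; pose t3 := t0 + 3 * d / 4.
pose b := expR (- t0); pose a := expR (- t3).
pose b' := expR (- t1); pose a' := expR (- t2).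
(* Lower bound of [(x - a) (b - x)] for [x] between [a'] and [b']. *)
pose eta := (b - b') * (a' - a).
have eta0 : 0 < eta.
  by apply: mulr_gt0; rewrite subr_gt0 ltr_expR ltrN2 /t1 /t2 /t3; lra.
have a01 : 0 <= a <= 1.
  by rewrite expR_ge0 -expR0 ler_expR oppr_le0 /t3; lra.
have b01 : 0 <= b <= 1 by rewrite expR_ge0 -expR0 ler_expR oppr_le0.
have a0 : 0 < a' by exact: expR_gt0.
pose q (t : R) := 1 - (expR (- `|t|) - a) * (expR (- `|t|) - b).
have bump n := exp_average1_bump mu_ uM u0 a01 b01 n 0.
have lower n (t : R) : 0 <= t ->
  - M * expR (- t) + a' * (n%:R * eta * c) * \1_(`[t1, t2]%classic) t
    <= expR (- t) * (q t ^+ n * u t).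
  move=> tge0; rewrite /q ger0_norm//; move: (expR_gt0 (- t)).
  have xa : (a <= expR (- t)) = (t <= t3) by rewrite ler_expR lerN2.
  have xb : (expR (- t) <= b) = (t0 <= t) by rewrite ler_expR lerN2.
  have xa' : (a' <= expR (- t)) = (t <= t2) by rewrite ler_expR lerN2.
  have xb' : (expR (- t) <= b') = (t1 <= t) by rewrite ler_expR lerN2.
  have x1 : expR (- t) <= 1 by rewrite -expR0 ler_expR oppr_le0.
  move: xa xb xa' xb' x1; move: (expR (- t)) => x xa xb xa' xb' x1 x0.
  rewrite indicE mem_setE in_itv/=.
  have [/andP[tt1 tt2]|_] := boolP (t1 <= t <= t2).
    have qt : 1 + eta <= 1 - (x - a) * (x - b).
      rewrite -xa' in tt2; rewrite -xb' in tt1.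
      have : (a' - a) * (b - b') <= (x - a) * (b - x).
        apply: ler_pM; [| |lra|lra].
        - by rewrite subr_ge0 ler_expR lerN2 /t2 /t3; lra.
        - by rewrite subr_ge0 ler_expR lerN2 /t1; lra.
      by rewrite /eta; lra.
    have uc : c <= u t.
      apply/ltW/ud; last by move: tt1; rewrite /t1; lra.
      rewrite /ball_/=; rewrite ltr_norml; move: tt1 tt2; rewrite /t1 /t2; lra.
    rewrite -xa' in tt2.
    have qn : n%:R * eta <= (1 - (x - a) * (x - b)) ^+ n.
      have bern : 1 + n%:R * eta <= (1 + eta) ^+ n.
        elim: n => [|m IHm]; first by rewrite mul0r addr0 expr0.
        rewrite exprS -natr1; have := ler_wpM2l (ltW (addr_gt0 ltr01 eta0)) IHm.
        apply: le_trans; have m0 : 0 <= m%:R :> R by [].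
        by have := mulr_ge0 m0 (mulr_ge0 (ltW eta0) (ltW eta0)); lra.
      have q1 : (1 + eta) ^+ n <= (1 - (x - a) * (x - b)) ^+ n.
        by rewrite lerXn2r ?nnegrE//; lra.
      by apply: (le_trans _ q1); lra.
    rewrite mulr1; apply: (@le_trans _ _ (a' * (n%:R * eta * c))).
      by rewrite gerDr mulNr oppr_le0 mulr_ge0// ltW.
    have n0 : 0 <= n%:R * eta * c := mulr_ge0 (mulr_ge0 (ler0n _ _) (ltW eta0)) (ltW c0).
    have ne0 : 0 <= n%:R * eta := mulr_ge0 (ler0n _ _) (ltW eta0).
    by apply: ler_pM => //; [exact: ltW|apply: ler_pM => //; exact: ltW].
  rewrite mulr0 addr0 [- M * x]mulrC ler_pM2l//.
  have [/andP[tt0 tt3]|] := boolP (t0 <= t <= t3).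
    rewrite (@le_trans _ _ 0) ?oppr_le0// mulr_ge0//.
      rewrite exprn_ge0//.
      have : (x - a) * (x - b) <= 0.
        by rewrite mulr_ge0_le0// ?subr_ge0 ?subr_le0 ?xa ?xb.
      by lra.
    (* The right neighbourhood excludes [t0], where positivity is the assumption being refuted. *)
    move: tt0; rewrite le_eqVlt => /predU1P[<-|tt0]; first exact: ltW.
    apply/ltW/(lt_trans c0)/ud => //.
    by rewrite /ball_/= ltr_norml; move: tt0 tt3; rewrite /t3; lra.
  rewrite negb_and -!ltNge => tout.
  have q1 : `|1 - (x - a) * (x - b)| <= 1.
    case/andP: a01 => a00 a11; case/andP: b01 => b00 b11.
    have p0 : 0 <= (x - a) * (x - b).
      case/orP: tout => tt.
        have bx : b <= x by rewrite ltW// ltNge xb -ltNge.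
        have ab : a <= b by rewrite ler_expR lerN2 /t3; lra.
        by rewrite mulr_ge0// subr_ge0//; lra.
      have xa1 : x <= a by rewrite ltW// ltNge xa -ltNge.
      have ab : a <= b by rewrite ler_expR lerN2 /t3; lra.
      by rewrite mulr_le0// subr_le0//; lra.
    have p1 : (x - a) * (x - b) <= 1 by nra.
    by rewrite ler_norml; lra.
  have : `|(1 - (x - a) * (x - b)) ^+ n * u t| <= M.
    rewrite normrM -[leRHS]mul1r ler_pM// normrX exprn_ile1//.
  by rewrite ler_norml => /andP[].
have key n : a' * (n%:R * eta * c) * (t2 - t1) <= M.
  have t12 : t1 < t2 by rewrite /t1 /t2; lra.
  have mt : (lebesgue_measure (`[t1, t2]%classic : set R) = (t2 - t1)%:E)%E.
    by rewrite lebesgue_measure_itv/= lte_fin t12 -EFinB.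
  have i1 : lebesgue_measure.-integrable setT
      (EFin \o (fun t => - M * exponential_pdf 1 t)).
    have := integrableZl measurableT (- M) (integrable_exponential_pdf (@ltr01 R)).
    by apply: eq_integrable.
  have i2 : lebesgue_measure.-integrable setT
      (EFin \o (\1_(`[t1, t2]%classic) : R -> R)).
    exact: integrable_indic_itv.
  have i3 : lebesgue_measure.-integrable setT
      (EFin \o (fun t => a' * (n%:R * eta * c) * \1_(`[t1, t2]%classic) t)).
    have := integrableZl measurableT (a' * (n%:R * eta * c)) i2.
    by apply: eq_integrable.
  have : (\int[lebesgue_measure]_t (- M * exponential_pdf 1 t +
     a' * (n%:R * eta * c) * \1_(`[t1, t2]%classic) t) <= 0 :> R)%R.
    rewrite -[leRHS](bump n); apply: le_Rintegral => //.
    - have := integrableD measurableT i1 i3.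
      by apply: eq_integrable.
    - have [mb bb] := bump_bounded mu_ uM a01 b01 n 0.
      exact: integrable_exp_weight bb.
    - move=> t _; have [t0'|t0'] := ltP t 0; last first.
        have := lower n t t0'; rewrite exponential_pdfE// mul1r mulN1r expr0 mul1r.
        by [].
      rewrite lt0_exponential_pdf// mulr0 mul0r add0r indicE mem_setE in_itv/=.
      rewrite [t1 <= t]leNgt (lt_trans t0') ?mulr0//.
      by rewrite /t1; lra.
  rewrite RintegralD// (RintegralZl _ measurableT (integrable_exponential_pdf ltr01)).
  rewrite (RintegralZl _ measurableT i2) /Rintegral integral_exponential_pdf//.
  rewrite integral_indic// setIT [X in _ + _ * fine X](_ : _ = (t2 - t1)%:E)//=.
  by rewrite mulr1; lra.
pose n := (Num.truncn (M / (a' * (eta * c) * (t2 - t1)))).+1.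
have D0 : 0 < a' * (eta * c) * (t2 - t1).
  by apply: mulr_gt0; [exact: mulr_gt0 a0 (mulr_gt0 eta0 c0)|rewrite /t1 /t2; lra].
have := key n; apply/negP; rewrite -ltNge.
have -> : a' * (n%:R * eta * c) * (t2 - t1) = n%:R * (a' * (eta * c) * (t2 - t1)).
  ring.
by rewrite -ltr_pdivrMr// truncnS_gt.
Qed.

Lemma exp_average_inj {R : realType} (M : R) (u v : R -> R) (t0 : R) :
    measurable_fun setT u -> measurable_fun setT v ->
    (forall t, `|u t| <= M) -> (forall t, `|v t| <= M) ->
    u s @[s --> t0^'+] --> u t0 -> v s @[s --> t0^'+] --> v t0 ->
    (forall l : R, 0 < l -> exp_average l u = exp_average l v) ->
  0 <= t0 -> u t0 = v t0.
Proof.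
move=> mu_ mv uM vM cu cv uv t00.
have le (f h : R -> R) : measurable_fun setT f -> measurable_fun setT h ->
    (forall t, `|f t| <= M) -> (forall t, `|h t| <= M) ->
    f s @[s --> t0^'+] --> f t0 -> h s @[s --> t0^'+] --> h t0 ->
    (forall l : R, 0 < l -> exp_average l f = exp_average l h) -> f t0 <= h t0.
  move=> mf mh fM hM cf ch fh; rewrite -subr_le0.
  apply: (@exp_average_inj_le0 _ (M + M) (fun t => f t - h t)) => //.
  - exact: measurable_funB.
  - by move=> t; rewrite (le_trans (ler_normB _ _))// lerD.
  - exact: cvgB.
  - by move=> l l0; rewrite (exp_averageB (M := M))// fh// subrr.
by apply/eqP; rewrite eq_le !le// => l l0; rewrite uv.
Qed.

(** * The state space *)

Section StateSpace.
Context {d : measure_display} {X : measurableType d} {R : realType}.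
Variables (G g : X -> R -> R).
Hypothesis hG : sojourn_law G g.

Lemma sojourn_nondecreasing (x : X) (s t : R) : 0 <= s -> s <= t ->
  G x s <= G x t.
Proof.
move=> s0 st; rewrite -lee_fin !(sojourn_density hG)//; last exact: le_trans st.
apply: ge0_subset_integral => //.
- apply/measurable_EFinP; apply: measurable_funS (density_measurable hG x) => //.
  by move=> u /=; rewrite !in_itv/= andbT => /andP[].
- by move=> u /=; rewrite in_itv/= => /andP[u0 _]; rewrite lee_fin (density_ge0 hG).
- by move=> u /=; rewrite !in_itv/= => /andP[-> /le_trans->].
Qed.

Lemma sojourn0 (x : X) : G x 0 = 0.
Proof.
by apply: EFin_inj; rewrite (sojourn_density hG)// set_itv1 integral_set1.
Qed.

(** Differentiability at an age where [G < 1] forbids a jump to 1 right after it. The witness is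
    rational to allow a countable union. *)
Lemma sojourn_lt1_right (x : X) (t : R) : 0 <= t -> G x t < 1 ->
  exists2 q : rat, t < ratr q & G x (ratr q) < 1.
Proof.
move=> t0 Gt; have := sojourn_derivative hG t0 Gt.
move/cvgrPdist_lt => /(_ 1 ltr01).
rewrite /incr_filter /= near_withinE near_withinE => -[e /= e0 he].
(* Close to [t] the increment of [G] stays below [(|g| + 1) h], which for [h < m] does not exhaust
   [1 - G x t]. *)
pose m := (1 - G x t) / (`|g x t| + 1).
have g1 : 0 < `|g x t| + 1 by rewrite ltr_wpDl.
have m0 : 0 < m by rewrite divr_gt0// subr_gt0.
have [q] := @rat_in_itvoo R t (t + Order.min e m) ltac:(by rewrite ltrDl lt_min e0 m0).
rewrite in_itv/= => /andP[tq]; rewrite -ltrBlDl lt_min => /andP[qe qm].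
exists q => //; set h := ratr q - t in qe qm.
have h0 : 0 < h by rewrite subr_gt0.
have qE : ratr q = t + h by rewrite /h addrC subrK.
have := he h; rewrite /ball_/= sub0r normrN gtr0_norm// => /(_ qe).
move=> /(_ (lt0r_neq0 h0)) /(_ (addr_ge0 t0 (ltW h0))).
rewrite /diff_quotient -qE distrC => dq.
have {}dq : (G x (ratr q) - G x t) / h < `|g x t| + 1.
  rewrite ltr_norml in dq; case/andP: dq => _ dq.
  have := ler_norm (g x t); lra.
rewrite ltr_pdivrMr// in dq.
have : (`|g x t| + 1) * h < 1 - G x t.
  by move: qm; rewrite /m ltr_pdivlMr// mulrC.
lra.
Qed.

(** [G] is given as measurable in the state at each fixed age. By monotonicity a rational age [q]
    with [G x q < 1] certifies all nonnegative ages below it, which leaves a countable union of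
    rectangles. *)
Lemma measurable_state_space : measurable (state_space G).
Proof.
have -> : state_space G = \bigcup_(q in [set q : rat | 0 <= ratr q :> R])
    ([set x | G x (ratr q) < 1] `*` `[0, (ratr q : R)[%classic).
  apply/seteqP; split => [[x t] [/= t0 Gt]|[x t] [q /= q0 [/= Gq]]].
    have [q tq Gq] := sojourn_lt1_right t0 Gt.
    exists q; first exact: le_trans (ltW tq).
    by split => //=; rewrite in_itv/= t0.
  rewrite in_itv/= => /andP[t0 tq]; split => //=.
  exact: le_lt_trans (sojourn_nondecreasing x t0 (ltW tq)) Gq.
rewrite bigcup_mkcond; apply: bigcupT_measurable_rat => q.
case: ifPn => [|_]; last exact: measurable0.
rewrite inE/= => q0; apply: measurableX => //.
have := sojourn_measurable hG q0 measurableT (measurable_itv `]-oo, (1:R)[).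
by rewrite setTI; congr measurable; apply/seteqP; split => x /=; rewrite in_itv.
Qed.

Lemma state_space_age0 (x : X) : state_space G (x, 0).
Proof. by split => //=; rewrite sojourn0. Qed.

End StateSpace.

(** * Semigroups, resolvents and uniqueness *)

Section ProbabilityIntegral.
Context {d : measure_display} {T : measurableType d} {R : realType}.
Variable (m : {measure set T -> \bar R}).
Hypothesis (m1 : m setT = 1%E).

Lemma eq_Rintegral_full (D : set T) (f h : T -> R) : measurable D -> m D = 1%E ->
    measurable_fun setT f -> measurable_fun setT h ->
    (forall z, D z -> f z = h z) ->
  (\int[m]_z f z)%R = (\int[m]_z h z)%R.
Proof.
move=> mD mD1 mf mh fh; congr fine; apply: ae_eq_integral => //.
- exact/measurable_EFinP.
- exact/measurable_EFinP.
- exists (~` D); split.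
  + exact: measurableC.
  + have mTD : (m setT - m D)%E = 0%E by rewrite m1 mD1 subee.
    have m1y : (m setT < +oo)%E by rewrite m1 ltry.
    by rewrite -setTD measureD// setTI.
  + by move=> z /= nz Dz; apply: nz => _; rewrite fh.
Qed.

Lemma le_norm_Rintegral_prob (f : T -> R) (M : R) : measurable_fun setT f ->
  (forall z, `|f z| <= M) -> `|(\int[m]_z f z)%R| <= M.
Proof.
move=> mf fM; have := @le_norm_Rintegral _ _ _ m f (cst M) mf _ fM.
rewrite Rintegral_cst// m1/= mulr1; apply.
by apply: (@integrable_bounded _ _ _ _ _ `|M|) => //; rewrite m1 ltry.
Qed.

(** Adding [M] makes the integrand nonnegative, as the integral against a composed kernel requires,
    and costs exactly [M] under mass 1. *)
Lemma integral_prob_addcst (f : T -> R) (M : R) : measurable_fun setT f ->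
    (forall z, `|f z| <= M) ->
  (\int[m]_z (f z + M)%:E)%E = ((\int[m]_z f z)%R + M)%:E.
Proof.
move=> mf fM; have m1y : (m setT < +oo)%E by rewrite m1 ltry.
have i1 := integrable_bounded m1y mf fM.
have i2 : m.-integrable setT (EFin \o cst M).
  by apply: (@integrable_bounded _ _ _ _ _ `|M|).
have cM : (\int[m]_z cst M z)%R = M by rewrite Rintegral_cst// m1/= mulr1.
have i12 : m.-integrable setT (fun z => (f z + M)%:E).
  by have := integrableD measurableT i1 i2; apply: eq_integrable.
rewrite -[X in (_ + X)%:E]cM -RintegralD// /Rintegral fineK//.
exact: integrable_fin_num.
Qed.

End ProbabilityIntegral.

Section TransitionSemigroup.
Context {d : measure_display} {X : measurableType d} {R : realType}.
Variables (D : set (X * R)) (p : R -> R.-pker (X * R)%type ~> (X * R)%type).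
Hypotheses (mD : measurable D) (hp : transition_semigroup D p).

Lemma semigroup_op_eq (t : R) (f h : X * R -> R) (z : X * R) :
    0 <= t -> D z -> measurable_fun setT f -> measurable_fun setT h ->
    (forall y, D y -> f y = h y) ->
  semigroup_op p t f z = semigroup_op p t h z.
Proof.
move=> t0 Dz; apply: eq_Rintegral_full => //; first exact: prob_kernel.
exact: (transition_conservative hp).
Qed.

Lemma integrable_semigroup (t : R) (f : X * R -> R) (z : X * R) (M : R) :
    measurable_fun setT f -> (forall y, `|f y| <= M) ->
  (p t z).-integrable setT (EFin \o f).
Proof. by apply: integrable_bounded; rewrite prob_kernel ltry. Qed.

Lemma semigroup_opD (s t : R) (f : X * R -> R) (z : X * R) (M : R) :
    0 <= s -> 0 <= t -> D z -> measurable_fun setT f ->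
    measurable_fun setT (semigroup_op p t f) -> (forall y, `|f y| <= M) ->
  semigroup_op p (s + t) f z = semigroup_op p s (semigroup_op p t f) z.
Proof.
move=> s0 t0 Dz mf mtf fM; apply: (@addIr _ M); apply: EFin_inj.
have tfM y : `|semigroup_op p t f y| <= M.
  by apply: le_norm_Rintegral_prob => //; exact: prob_kernel.
rewrite /semigroup_op -!integral_prob_addcst//; try exact: prob_kernel.
rewrite (@eq_measure_integral _ _ _ setT
  (mkcomp (p s) (kernel.kernel_snd (p t)) z)); last first.
  by move=> B mB _; rewrite [LHS](chapman_kolmogorov hp).
rewrite integral_kcomp//.
- by apply: eq_integral => y _; rewrite -integral_prob_addcst//; exact: prob_kernel.
- by move=> y; rewrite lee_fin -lerBlDr sub0r; have := fM y; rewrite ler_norml => /andP[].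
- by apply/measurable_EFinP; exact: measurable_funD.
Qed.

End TransitionSemigroup.

Section GeneratedSemigroup.
Context {d : measure_display} {X : measurableType d} {R : realType}.
Variables (P : R.-pker X ~> X) (G g : X -> R -> R)
  (p : R -> R.-pker (X * R)%type ~> (X * R)%type).
Hypotheses (hG : sojourn_law G g) (hp : generated_by P G g p).

Let D := state_space G.
Let mD : measurable D := measurable_state_space hG.

(* Extended by its value at 0 to negative times and killed outside the state
   space, so that it is bounded and right-continuous everywhere. *)
Definition semigroup_path (f : X * R -> R) (z : X * R) (t : R) : R :=
  semigroup_op p (Order.max t 0) f z * \1_(state_space G) z.

Lemma semigroup_path_in f z t : 0 <= t -> D z ->
  semigroup_path f z t = semigroup_op p t f z.
Proof.
by move=> t0 Dz; rewrite /semigroup_path indicE mem_set// mulr1 max_l.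
Qed.

Lemma semigroup_op0 f z : D z -> measurable_fun setT f ->
  semigroup_op p 0 f z = f z.
Proof.
move=> Dz mf; rewrite /semigroup_op /Rintegral.
rewrite (@eq_measure_integral _ _ _ setT (dirac z)); last first.
  by move=> B mB _; rewrite [LHS](transition0 (generated_semigroup hp)).
rewrite integral_dirac//; last exact/measurable_EFinP.
by rewrite diracT mul1e.
Qed.

Section BoundedTestFunction.
Variables (f : X * R -> R) (M : R).
Hypotheses (tf : test_function G f) (fM : forall z, `|f z| <= M).

Let mf : measurable_fun setT f. Proof. by case: tf. Qed.

Lemma test_semigroup t : 0 <= t -> test_function G (semigroup_op p t f).
Proof. by move=> t0; exact: generated_stable hp _ _ t0 tf. Qed.

Lemma measurable_semigroup t : 0 <= t ->
  measurable_fun setT (semigroup_op p t f).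
Proof. by case/test_semigroup. Qed.

Lemma le_norm_semigroup t z : `|semigroup_op p t f z| <= M.
Proof. by apply: le_norm_Rintegral_prob => //; exact: prob_kernel. Qed.

Lemma semigroup_add s t z : 0 <= s -> 0 <= t -> D z ->
  semigroup_op p (s + t) f z = semigroup_op p s (semigroup_op p t f) z.
Proof.
move=> s0 t0 Dz; apply: (semigroup_opD (generated_semigroup hp) _ _ _ _ _ fM) => //.
exact: measurable_semigroup.
Qed.

Lemma le_norm_semigroup_path z t : `|semigroup_path f z t| <= M.
Proof.
rewrite normrM indicE; case: (_ \in _).
  by rewrite normr1 mulr1 le_norm_semigroup.
by rewrite normr0 mulr0 (le_trans _ (fM z)).
Qed.

Lemma measurable_semigroup_path_state t :
  measurable_fun setT (semigroup_path f ^~ t).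
Proof.
apply: measurable_funM; last exact: measurable_indic.
by apply: measurable_semigroup; rewrite le_max lexx orbT.
Qed.

(** [generated_continuous] speaks of time 0 only. As [p_t f] is again a test function,
    [p_s f = p_{s-t} (p_t f)] carries continuity to time [t], from the right. *)
Lemma semigroup_path_right_cont z t :
  semigroup_path f z s @[s --> t^'+] --> semigroup_path f z t.
Proof.
have [Dz|nDz] := pselect (D z); last first.
  rewrite /semigroup_path indicE memNset// mulr0.
  by under eq_fun do rewrite mulr0; exact: cvg_cst.
have [t0|t0] := ltP t 0.
  apply: (cvg_trans (G := semigroup_path f z t @[s --> t^'+])); last exact: cvg_cst.
  apply: near_eq_cvg; near=> s.
  have s0 : s < 0 by near: s; exact: nbhs_right_lt.
  by rewrite /semigroup_path !max_r// ltW.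
rewrite semigroup_path_in//; apply/cvg_at_rightP => u [ut cu].
have := generated_continuous hp (test_semigroup t0) Dz.
move=> /cvg_at_rightP /(_ (fun n => u n - t)).
have cut : u n - t @[n --> \oo] --> 0.
  by rewrite -(subrr t); apply: cvgB => //; exact: cvg_cst.
move=> /(_ (conj (fun n => _) cut)) H.
have {}H : semigroup_op p (u n - t) (semigroup_op p t f) z @[n --> \oo]
    --> semigroup_op p t f z.
  by apply: H => n; rewrite subr_gt0.
apply: cvg_trans H; apply: near_eq_cvg; apply: nearW => n.
rewrite semigroup_path_in//; last by rewrite (le_trans t0)// ltW.
by rewrite -semigroup_add ?subrK// subr_ge0 ltW.
Unshelve. all: by end_near. Qed.

Lemma measurable_semigroup_path_joint :
  measurable_fun setT (fun tz : R * (X * R) => semigroup_path f tz.2 tz.1).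
Proof.
apply: (measurable_right_continuous (u := fun t z => semigroup_path f z t)).
- exact: measurable_semigroup_path_state.
- by move=> t z; exact: semigroup_path_right_cont.
Qed.

Lemma measurable_semigroup_path z : measurable_fun setT (semigroup_path f z).
Proof.
exact: (measurable_fun_pair1 (f := fun tz => semigroup_path f tz.2 tz.1) _
  measurable_semigroup_path_joint).
Qed.

End BoundedTestFunction.
End GeneratedSemigroup.

Section KernelProbability.
Context {d d' : measure_display} {S : measurableType d} {T : measurableType d'}
  {R : realType}.
Variables (k : R.-pker S ~> T) (x : S).

(** Packages the fibre [k x] as a [probability], the form in which [Rintegral_exp_average] takes its
    measure. *)
Definition kernel_prob : set T -> \bar R := k x.

HB.instance Definition _ := Measure.on kernel_prob.

HB.instance Definition _ :=
  Measure_isProbability.Build _ _ _ kernel_prob (@prob_kernel _ _ _ _ _ k x).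

End KernelProbability.

Section ExpAverageParameter.
Context {d : measure_display} {T : measurableType d} {R : realType}.
Variables (l M : R) (F : R * T -> R).
Hypotheses (l0 : 0 < l) (mF : measurable_fun setT F)
  (FM : forall ty, `|F ty| <= M).

Let mFt (y : T) : measurable_fun setT (fun t : R => F (t, y)).
Proof. exact: measurable_fun_pair1. Qed.

Let mFy (t : R) : measurable_fun setT (fun y : T => F (t, y)).
Proof. exact: measurable_fun_pair2. Qed.

Let wF (ty : R * T) : R := exponential_pdf l ty.1 * F ty.

Let mwF : measurable_fun setT wF.
Proof.
apply: measurable_funM => //; apply: measurableT_comp => //.
exact: measurable_exponential_pdf.
Qed.

Let intwF y : lebesgue_measure.-integrable setT (fun t : R => (wF (t, y))%:E).
Proof.
exact: (@integrable_exp_weight _ l M (fun t => F (t, y)) l0 (mFt y) (fun t => FM (t, y))).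
Qed.

Lemma Rintegral_exp_average (m : probability T R) :
  (\int[m]_y exp_average l (fun t => F (t, y)))%R =
  exp_average l (fun t => (\int[m]_y F (t, y))%R).
Proof.
have intF t : m.-integrable setT (EFin \o (fun y => F (t, y))).
  by apply: (integrable_bounded (M := M)) => //; rewrite [ltLHS]probability_setT ltry.
have intwFy t : m.-integrable setT (fun y => (wF (t, y))%:E).
  have := integrableZl measurableT (exponential_pdf l t) (intF t).
  by apply: eq_integrable.
have mewF : measurable_fun setT (EFin \o wF) by exact/measurable_EFinP.
have intw : (lebesgue_measure \x m)%E.-integrable setT (EFin \o wF).
  apply/integrable12ltyP => //.
  apply: (@le_lt_trans _ _ (\int[lebesgue_measure]_(t in setT)
      (M%:E * (exponential_pdf l t)%:E))%E).
    apply: ge0_le_integral => //.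
    - by move=> t _; exact: integral_ge0.
    - have mabs : measurable_fun setT (abse \o (EFin \o wF)).
        exact: measurableT_comp.
      have := @measurable_fun_fubini_tonelli_F _ _ _ _ _ m _ mabs (fun ty => abse_ge0 _).
      exact.
    - apply: emeasurable_funM => //; apply/measurable_EFinP.
      exact: measurable_exponential_pdf.
    - move=> t _; have k0 := exponential_pdf_ge0 (ltW l0) t.
      apply: (@le_trans _ _ (\int[m]_(y in setT) cst (M * exponential_pdf l t)%:E y)%E).
        apply: ge0_le_integral => //.
        + apply: measurableT_comp => //; apply/measurable_EFinP.
          exact: measurable_fun_pair2.
        + move=> y _ /=; rewrite lee_fin /wF/= normrM (ger0_norm k0) mulrC.
          by rewrite ler_wpM2r.
      by rewrite integral_cst// [X in (_ * X)%E]probability_setT mule1.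
  rewrite integralZl//; last exact: integrable_exponential_pdf.
  by rewrite integral_exponential_pdf// mule1 ltry.
have := Fubini intw; rewrite /exp_average /Rintegral => FE; congr fine.
transitivity (\int[m]_y \int[lebesgue_measure]_t (EFin \o wF) (t, y))%E.
  apply: eq_integral => y _; rewrite fineK//.
  exact: integrable_fin_num (intwF y).
rewrite -FE; apply: eq_integral => t _.
rewrite -/(Rintegral m setT (fun y => F (t, y))) -RintegralZl//.
rewrite /Rintegral fineK//.
exact: integrable_fin_num (intwFy t).
Qed.

Lemma measurable_exp_average :
  measurable_fun setT (fun y => exp_average l (fun t => F (t, y))).
Proof.
(* Shifting by [M] gives Tonelli a nonnegative integrand; the density has mass 1, so the shift comes
   out as [M]. *)
rewrite (_ : (fun y => _) = fun y => fine
    (\int[lebesgue_measure]_t (exponential_pdf l t * (F (t, y) + M))%:E)%E - M).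
  apply: measurable_funB => //; apply: measurableT_comp => //.
  apply: (measurable_fun_fubini_tonelli_G (m1 := lebesgue_measure)
    (fun ty => (exponential_pdf l ty.1 * (F ty + M))%:E)) => //.
    apply/measurable_EFinP; apply: measurable_funM.
      by apply: measurableT_comp => //; exact: measurable_exponential_pdf.
    exact: measurable_funD.
  move=> ty; rewrite lee_fin mulr_ge0 ?exponential_pdf_ge0 ?(ltW l0)//.
  by rewrite -lerBlDr sub0r; have := FM ty; rewrite ler_norml => /andP[].
apply/funext => y; apply/eqP; rewrite eq_sym subr_eq; apply/eqP.
rewrite -[X in _ = _ + X](exp_average_cst M l0) /exp_average -RintegralD//.
  by apply: eq_Rintegral => t _; rewrite mulrDr.
- exact: intwF.
- by apply: (integrable_exp_weight l0 (M := `|M|)).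
Qed.

End ExpAverageParameter.

(** Dominated convergence handles sequences, so continuity in the age is tested along them: if
    convergence fails, some points of [A] within [1/(n+1)] of [a] have images [e] away from [l]. *)
Lemma cvg_within_seq {R : realType} (A : set R) (f : R -> R) (a : R) (l : R) :
    (forall u : nat -> R, (forall n, A (u n)) -> u n @[n --> \oo] --> a ->
       f (u n) @[n --> \oo] --> l) ->
  f t @[t --> within A (nbhs a)] --> l.
Proof.
move=> cvgf; apply/cvgrPdist_lt => e e0; rewrite near_withinE.
apply: contrapT => nnear.
have /choice[u /all_and3[uA ua ufe]] (n : nat) : exists v : R,
    [/\ A v, `|a - v| < n.+1%:R^-1 & e <= `|l - f v|].
  apply: contrapT => nex; apply: nnear.
  exists n.+1%:R^-1 => //= v av Av.
  by rewrite ltNge; apply/negP => ev; apply: nex; exists v.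
have cu : u n @[n --> \oo] --> a.
  apply/cvgrPdist_lt => e' e'0.
  have : (fun n => n.+1%:R^-1 : R) @ \oo --> 0 by exact: cvg_harmonic.
  move=> /cvgrPdist_lt /(_ e' e'0); apply: filterS => n.
  rewrite sub0r normrN ger0_norm// => /(lt_trans (ua n)); exact.
have /cvgrPdist_lt /(_ e e0) [N _ /(_ N)] := cvgf u uA cu.
by move=> /(_ (leqnn N)); rewrite ltNge ufe.
Qed.

(** * Resolvents of test functions lie in the domain of the generator *)

Section Resolvent.
Context {d : measure_display} {X : measurableType d} {R : realType}.
Variables (P : R.-pker X ~> X) (G g : X -> R -> R)
  (p : R -> R.-pker (X * R)%type ~> (X * R)%type).
Hypotheses (hG : sojourn_law G g) (hp : generated_by P G g p).

Let D := state_space G.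
Let mD : measurable D := measurable_state_space hG.

(* [l] times the resolvent of the semigroup at [l]. *)
Definition averaged_semigroup (l : R) (f : X * R -> R) (z : X * R) : R :=
  exp_average l (semigroup_path G p f z).

Variables (l M : R) (f : X * R -> R).
Hypotheses (l0 : 0 < l) (tf : test_function G f) (fM : forall z, `|f z| <= M).

Let V := averaged_semigroup l f.
Let mf : measurable_fun setT f. Proof. by case: tf. Qed.
Let mpath z := measurable_semigroup_path hG hp tf fM z.
Let pathM z t : `|semigroup_path G p f z t| <= M.
Proof. exact: le_norm_semigroup_path. Qed.

Lemma le_norm_averaged_semigroup z : `|V z| <= M.
Proof. exact: le_norm_exp_average. Qed.

(** Each [p_t f] is continuous in the age; dominated convergence, with [M] times the density as
    majorant, passes this to the average. *)
Lemma averaged_semigroup_test : test_function G V.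
Proof.
split.
- apply: (measurable_exp_average (F := fun tz => semigroup_path G p f tz.2 tz.1)
     (M := M)) => //.
  exact: (measurable_semigroup_path_joint hG hp tf fM).
- by exists M => z _; exact: le_norm_averaged_semigroup.
- move=> x; apply/subspace_continuousP => a Da.
  apply: cvg_within_seq => u uD ua.
  apply: (@Rintegral_dominated_cvg _ _ _ lebesgue_measure
    (fun n t => exponential_pdf l t * semigroup_path G p f (x, u n) t)
    (fun t => exponential_pdf l t * semigroup_path G p f (x, a) t)
    (fun t => exponential_pdf l t * M)).
  + move=> n; apply: measurable_funM; last exact: mpath.
    exact: measurable_exponential_pdf.
  + move=> t; apply: cvgM; first exact: cvg_cst.
    have inD v : D (x, v) -> semigroup_path G p f (x, v) t =
        semigroup_op p (Order.max t 0) f (x, v).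
      by move=> Dv; rewrite /semigroup_path indicE mem_set// mulr1.
    rewrite (inD _ Da); under eq_fun do rewrite (inD _ (uD _)).
    have t0 : 0 <= Order.max t 0 by rewrite le_max lexx orbT.
    have [_ _ /(_ x) /subspace_continuousP /(_ a Da) ct] := test_semigroup hp tf t0.
    have uaD : u n @[n --> \oo] --> within [set v | state_space G (x, v)] (nbhs a).
      move=> B /=; rewrite /within/= => aB.
      have aBu : \forall n \near \oo, state_space G (x, u n) -> B (u n) := ua _ aB.
      suff : \forall n \near \oo, B (u n) by [].
      by apply: filterS aBu => n AB; exact: AB (uD n).
    exact: cvg_comp uaD ct.
  + by apply: (integrable_exp_weight l0 (u := cst M) (M := `|M|)).
  + move=> n t; have k0 := exponential_pdf_ge0 (ltW l0) t.
    by rewrite normrM (ger0_norm k0) ler_wpM2l.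
Qed.

(** Fubini moves [p_h] inside the time average, where [p_h p_t = p_{t+h}]. The artificial values at
    negative times need not satisfy this identity, but they carry no weight. *)
Lemma semigroup_averaged h z : 0 <= h -> D z ->
  semigroup_op p h V z = exp_average l (fun t => semigroup_path G p f z (t + h)).
Proof.
move=> h0 Dz.
have := @Rintegral_exp_average _ _ _ l M
   (fun tz => semigroup_path G p f tz.2 tz.1) l0
   (measurable_semigroup_path_joint hG hp tf fM) (fun ty => pathM _ _)
   (kernel_prob (p h) z).
rewrite -[LHS]/(semigroup_op p h V z) => ->.
apply: eq_Rintegral => t _.
have [t0|t0] := ltP t 0; first by rewrite lt0_exponential_pdf// !mul0r.
congr (_ * _).
rewrite semigroup_path_in ?addr_ge0// addrC (semigroup_add hp tf fM)//.
apply: (semigroup_op_eq mD (generated_semigroup hp)) => //.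
- exact: (measurable_semigroup_path_state hG hp tf).
- exact: (measurable_semigroup hp tf).
- by move=> y Dy; rewrite semigroup_path_in.
Qed.

(** The difference quotient of [V] at [z] is that of the exponential average along
    [t |-> p_t f (z)], which starts at [f z]. The bound is uniform in [z] and the limit pointwise,
    exactly as [weak_generator] asks. *)
Lemma averaged_semigroup_generator :
  weak_generator D p V (fun z => l * (V z - f z)).
Proof.
split.
  exists (2 * M * l) => h z h0 Dz; rewrite (semigroup_averaged (ltW h0) Dz).
  rewrite normrM normfV (gtr0_norm h0) ler_pdivrMr//.
  exact: exp_average_incr_le.
move=> z Dz; apply/cvgrPdist_le => e e0.
have : semigroup_path G p f z s @[s --> 0^'+] --> semigroup_path G p f z 0.
  exact: (semigroup_path_right_cont hp tf fM).
have e2 : 0 < e / 2 / l by rewrite !divr_gt0.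
move=> /cvgrPdist_le /(_ _ e2) [dl /= dl0 near0].
have C0 : 0 <= 4 * M * l ^+ 2.
  by rewrite !mulr_ge0 ?exprn_ge0 ?(ltW l0)//; exact: le_trans (fM z).
have C1 : 0 < 4 * M * l ^+ 2 + 1 by rewrite ltr_wpDl.
near=> h.
have h0 : 0 < h by near: h; exact: nbhs_right_gt.
have hdl : h < dl by near: h; exact: nbhs_right_lt.
rewrite (semigroup_averaged (ltW h0) Dz).
have path0 : semigroup_path G p f z 0 = f z.
  by rewrite semigroup_path_in// (semigroup_op0 hp).
rewrite distrC -path0.
apply: (le_trans (exp_average_incr_close l0 (mpath z) (pathM z) h0
  (e := e / 2 / l) _)).
  move=> t /andP[]; rewrite le_eqVlt => /predU1P[<- _|t0 th].
    by rewrite subrr normr0 ltW.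
  rewrite distrC; apply: near0 => //=.
  by rewrite sub0r normrN gtr0_norm// (lt_trans th).
have -> : l * (e / 2 / l) = e / 2 by rewrite mulrC divfK ?gt_eqF.
have : 4 * M * l ^+ 2 * h <= e / 2.
  apply: (@le_trans _ _ ((4 * M * l ^+ 2 + 1) * h)).
    by rewrite ler_wpM2r ?(ltW h0)// lerDl.
  rewrite mulrC -ler_pdivlMr//; apply: ltW; near: h; apply: nbhs_right_lt.
  by apply: divr_gt0 => //; exact: divr_gt0.
lra.
Unshelve. all: by end_near. Qed.

End Resolvent.

(** * The generator determines the semigroup on bounded test functions *)

Section Uniqueness.
Context {d : measure_display} {X : measurableType d} {R : realType}.
Variables (P : R.-pker X ~> X) (G g : X -> R -> R).
Hypotheses (hG : sojourn_law G g).

Let D := state_space G.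
Let mD : measurable D := measurable_state_space hG.

(** An integration by parts: the averaged difference quotients of [t |-> p_t f (z)] along [1/(n+1)]
    have two limits. Inside [p_t] the bounded quotients of [f] tend to [v]; as increments of the
    average they tend to the right-hand side. *)
Lemma averaged_generator (p : R -> R.-pker (X * R)%type ~> (X * R)%type)
    (l M L : R) (f v : X * R -> R) (z : X * R) :
    generated_by P G g p -> 0 < l ->
    test_function G f -> (forall y, `|f y| <= M) ->
    test_function G v -> (forall y, `|v y| <= L) ->
    weak_generator D p f v -> D z ->
  averaged_semigroup G p l v z = l * (averaged_semigroup G p l f z - f z).
Proof.
move=> hp l0 tf fM tv vL [[C fC] cvgf] Dz.
have mf : measurable_fun setT f by case: tf.
have mv : measurable_fun setT v by case: tv.
have C0 : 0 <= C := le_trans (normr_ge0 _) (fC 1 z ltr01 Dz).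
pose e (n : nat) : R := n.+1%:R^-1.
have e0 n : 0 < e n by rewrite invr_gt0.
have cvge : e n @[n --> \oo] --> 0 by exact: cvg_harmonic.
(* The quotients are bounded by [C] on [D] only. The cut-off makes the bound global and changes no
   integral, since [p_t] gives [D] full mass. *)
pose q n y := (semigroup_op p (e n) f y - f y) / e n * \1_D y.
have mS t : 0 <= t -> measurable_fun setT (semigroup_op p t f).
  exact: (measurable_semigroup hp tf).
have mq n : measurable_fun setT (q n).
  apply: measurable_funM; last exact: measurable_indic.
  by apply: measurable_funM => //; apply: measurable_funB => //; exact: mS _ (ltW (e0 n)).
have qC n y : `|q n y| <= C.
  have [Dy|nDy] := pselect (D y); rewrite /q indicE.
    by rewrite mem_set// mulr1 fC.
  by rewrite memNset// mulr0 normr0.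
have cvgq y : q n y @[n --> \oo] --> v y * \1_D y.
  have [Dy|nDy] := pselect (D y); rewrite /q indicE; last first.
    by rewrite memNset// mulr0; under eq_fun do rewrite mulr0; exact: cvg_cst.
  rewrite mem_set// mulr1; under eq_fun do rewrite mulr1.
  by have /cvg_at_rightP := cvgf y Dy; apply; split.
have cvgS t : 0 <= t -> semigroup_op p t (q n) z @[n --> \oo] --> semigroup_op p t v z.
  move=> t0.
  have -> : semigroup_op p t v z = semigroup_op p t (fun y => v y * \1_D y) z.
    apply: (semigroup_op_eq mD (generated_semigroup hp)) => //.
      by apply: measurable_funM => //; exact: measurable_indic.
    by move=> y Dy; rewrite indicE mem_set// mulr1.
  apply: (@Rintegral_dominated_cvg _ _ _ (p t z) q _ (cst C)) => //.
  by apply: (@integrable_semigroup _ _ _ _ _ _ _ (`|C|)) => //.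
have qE t n : 0 <= t -> semigroup_op p t (q n) z =
    (semigroup_path G p f z (t + e n) - semigroup_path G p f z t) / e n.
  move=> t0; rewrite !semigroup_path_in ?addr_ge0 ?(ltW (e0 n))//.
  rewrite (semigroup_add hp tf fM) ?(ltW (e0 n))//.
  have me := mS _ (ltW (e0 n)).
  have eM y : `|semigroup_op p (e n) f y| <= M by apply: (@le_norm_semigroup _ _ _ G).
  have mB : measurable_fun setT (fun y => semigroup_op p (e n) f y - f y).
    exact: measurable_funB.
  rewrite (_ : semigroup_op p t (q n) z =
      semigroup_op p t (fun y => (semigroup_op p (e n) f y - f y) / e n) z).
    rewrite {1}/semigroup_op RintegralZr// ?RintegralB//.
    - exact: (integrable_semigroup _ _ _ _ eM).
    - exact: (integrable_semigroup _ _ _ _ fM).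
    - apply: (@integrable_semigroup _ _ _ _ _ _ _ (M + M)) => // y.
      by rewrite (le_trans (ler_normB _ _))// lerD.
  apply: (semigroup_op_eq mD (generated_semigroup hp)) => //.
    exact: measurable_funM.
  by move=> y Dy; rewrite /q indicE mem_set// mulr1.
have mpath w : measurable_fun setT (semigroup_path G p f w).
  exact: (measurable_semigroup_path hG hp tf fM).
have pathM w t : `|semigroup_path G p f w t| <= M by exact: le_norm_semigroup_path.
pose dpath n t := (semigroup_path G p f z (t + e n) - semigroup_path G p f z t) / e n.
have mshift n : measurable_fun setT (fun t : R => semigroup_path G p f z (t + e n)).
  by apply: measurableT_comp => //; exact: measurable_funD.
have mdpath n : measurable_fun setT (dpath n).
  by apply: measurable_funM => //; exact: measurable_funB.
have lim1 : exp_average l (dpath n) @[n --> \oo] --> averaged_semigroup G p l v z.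
  apply: (@Rintegral_dominated_cvg _ _ _ lebesgue_measure
    (fun n t => exponential_pdf l t * dpath n t)
    (fun t => exponential_pdf l t * semigroup_path G p v z t)
    (fun t => exponential_pdf l t * C)).
  - move=> n; apply: measurable_funM; last exact: mdpath.
    exact: measurable_exponential_pdf.
  - move=> t; have [t0|t0] := ltP t 0.
      rewrite lt0_exponential_pdf// mul0r.
      by under eq_fun do rewrite mul0r; exact: cvg_cst.
    apply: cvgM; first exact: cvg_cst.
    rewrite semigroup_path_in// /dpath.
    under eq_fun do rewrite -qE//.
    exact: cvgS.
  - by apply: (integrable_exp_weight l0 (u := cst C) (M := `|C|)).
  - move=> n t; have k0 := exponential_pdf_ge0 (ltW l0) t.
    have [t0|t0] := ltP t 0; first by rewrite lt0_exponential_pdf// !mul0r normr0.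
    rewrite normrM (ger0_norm k0) ler_wpM2l// /dpath -qE//.
    by apply: le_norm_Rintegral_prob => //; exact: prob_kernel.
have lim2 : exp_average l (dpath n) @[n --> \oo] -->
    l * (averaged_semigroup G p l f z - f z).
  have [_ /(_ z Dz) /cvg_at_rightP] := averaged_semigroup_generator hG hp l0 tf fM.
  move=> /(_ e (conj e0 cvge)).
  apply: cvg_trans; apply: near_eq_cvg; apply: nearW => n.
  rewrite (semigroup_averaged hG hp l0 tf fM (ltW (e0 n)) Dz) /dpath.
  rewrite /averaged_semigroup -(exp_averageB (M := M))//.
  rewrite mulrC -(exp_averageZ (M := M + M))//.
  - by congr exp_average; apply/funext => t; rewrite mulrC.
  - exact: measurable_funB.
  - by move=> t; rewrite (le_trans (ler_normB _ _))// lerD.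
exact: cvg_unique lim1 lim2.
Qed.

Lemma generated_semigroup_unique
    (p q : R -> R.-pker (X * R)%type ~> (X * R)%type) (M t : R)
    (f : X * R -> R) (z : X * R) :
    generated_by P G g p -> generated_by P G g q ->
    test_function G f -> (forall y, `|f y| <= M) -> 0 <= t -> D z ->
  semigroup_op p t f z = semigroup_op q t f z.
Proof.
move=> hp hq tf fM t0 Dz.
rewrite -(semigroup_path_in p f t0 Dz) -(semigroup_path_in q f t0 Dz).
apply: (@exp_average_inj _ M) => //.
- exact: (measurable_semigroup_path hG hp tf fM).
- exact: (measurable_semigroup_path hG hq tf fM).
- by move=> s; exact: le_norm_semigroup_path.
- by move=> s; exact: le_norm_semigroup_path.
- exact: (semigroup_path_right_cont hp tf fM).
- exact: (semigroup_path_right_cont hq tf fM).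
move=> l l0; rewrite -!/(averaged_semigroup _ _ _ _ _).
pose V := averaged_semigroup G p l f.
have tV : test_function G V := averaged_semigroup_test hG hp l0 tf fM.
have VM y : `|V y| <= M by exact: (le_norm_averaged_semigroup hG hp l0 tf fM).
pose v y := l * (V y - f y).
have vM y : `|v y| <= l * (M + M).
  rewrite normrM (gtr0_norm l0) ler_wpM2l ?(ltW l0)//.
  by rewrite (le_trans (ler_normB _ _))// lerD.
have tv : test_function G v.
  have [mV _ cV] := tV; have [mf _ cf] := tf; split.
  - by apply: measurable_funM => //; exact: measurable_funB.
  - by exists (l * (M + M)) => y _.
  - move=> x; apply/subspace_continuousP => a Da.
    apply: cvgM; first exact: cvg_cst.
    apply: cvgB.
      by have /subspace_continuousP := cV x; apply.
    by have /subspace_continuousP := cf x; apply.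
have wp : weak_generator D p V v := averaged_semigroup_generator hG hp l0 tf fM.
have wq : weak_generator D q V v.
  apply/(generated_generator hq tV tv); exact/(generated_generator hp tV tv).
(* Writing [A] for the average along [q], this is [A v = l (A V - V)], while linearity gives
   [A v = l (A V - A f)]; hence [A f = V]. *)
have := averaged_generator hq l0 tV VM tv vM wq Dz.
rewrite /averaged_semigroup (_ : semigroup_path G q v z =
  fun s => l * (semigroup_path G q V z s - semigroup_path G q f z s)); last first.
  have [mV _ _] := tV; have [mf _ _] := tf.
  apply/funext => s; rewrite /semigroup_path indicE mem_set// !mulr1.
  rewrite /semigroup_op /v RintegralZl// ?RintegralB//.
  - exact: (integrable_semigroup _ _ _ _ VM).
  - exact: (integrable_semigroup _ _ _ _ fM).
  - apply: (@integrable_semigroup _ _ _ _ _ _ _ (M + M)) => [|y].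
      exact: measurable_funB.
    by rewrite (le_trans (ler_normB _ _))// lerD.
have mqV := measurable_semigroup_path hG hq tV VM z.
have mqf := measurable_semigroup_path hG hq tf fM z.
have qVM s : `|semigroup_path G q V z s| <= M by exact: le_norm_semigroup_path.
have qfM s : `|semigroup_path G q f z s| <= M by exact: le_norm_semigroup_path.
rewrite (exp_averageZ (M := M + M))//; first last.
- by move=> s; rewrite (le_trans (ler_normB _ _))// lerD.
- exact: measurable_funB.
rewrite (exp_averageB (M := M))// => /(mulfI (lt0r_neq0 l0)).
by move=> /addrI /oppr_inj ->.
Qed.

End Uniqueness.

(** * From test functions to transition kernels *)

Section Determination.
Context {d : measure_display} {X : measurableType d} {R : realType}.

(** A pi-system suited to test functions: continuity is required in the age alone, so [B] is an
    arbitrary measurable set and only the half-line needs approximation. *)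
Let lower : set (set (X * R)) := [set A | exists B (a : R),
  measurable B /\ A = B `*` `]-oo, a[%classic].

(** Both projections are measurable for the generated sigma-algebra: the cylinder over [B] is the
    union of its rectangles with [a = k], and open half-lines generate the Borel sets. *)
Lemma measurable_lower_rectangles : @measurable _ (X * R)%type = <<s lower >>.
Proof.
pose S := g_sigma_algebraType lower.
have covered : \bigcup_k `]-oo, (k%:R : R)[%classic = [set: R].
  apply/seteqP; split => // t _; exists (Num.truncn `|t|).+1 => //=.
  by rewrite in_itv/= (le_lt_trans (ler_norm t))// truncnS_gt.
have mfst : measurable_fun [set: S] (fst : S -> X).
  move=> _ B mB; rewrite setTI.
  have -> : (fst : S -> X) @^-1` B =
      \bigcup_k (B `*` `]-oo, (k%:R : R)[%classic).
    by rewrite -setX_bigcupr covered; apply/seteqP; split => z //= [].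
  apply: bigcupT_measurable => k; apply: sub_sigma_algebra.
  by exists B, k%:R.
have msnd : measurable_fun [set: S] (snd : S -> R).
  have := @measurability _ _ S (measurableTypeR R) setT snd _ (RGenInftyO.measurableE R).
  apply => _ [_ [a ->] <-].
  rewrite setTI; apply: sub_sigma_algebra.
  by exists setT, a; split => //; apply/seteqP; split => z //= [].
apply/seteqP; split.
  rewrite measurable_prod_measurableType; apply: smallest_sub.
    exact: smallest_sigma_algebra.
  move=> _ [B mB [C mC <-]].
  have -> : B `*` C = (fst : S -> X) @^-1` B `&` (snd : S -> R) @^-1` C by [].
  have := measurableI _ _ (mfst measurableT _ mB) (msnd measurableT _ mC).
  by rewrite !setTI.
apply: smallest_sub; first exact: sigma_algebra_measurable.
by move=> _ [B [a [mB ->]]]; exact: measurableX.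
Qed.

Lemma measure_lower_rectangles_unique (m1 m2 : {measure set (X * R) -> \bar R}) :
    (m1 setT < +oo)%E ->
    (forall (B : set X) (a : R), measurable B ->
      m1 (B `*` `]-oo, a[%classic) = m2 (B `*` `]-oo, a[%classic)) ->
  forall A, measurable A -> m1 A = m2 A.
Proof.
move=> m1T m12 A mA.
apply: (measure_unique lower (fun k => setT `*` `]-oo, (k%:R : R)[%classic)) => //.
- exact: measurable_lower_rectangles.
- move=> _ _ [B [a [mB ->]]] [C [b [mC ->]]].
  exists (B `&` C), (Order.min a b); split; first exact: measurableI.
  rewrite -setXI; congr (_ `*` _); apply/seteqP; split => t /=; rewrite !in_itv/= lt_min.
    by case=> -> ->.
  by move/andP.
- by move=> k; exists setT, k%:R.
- rewrite -setX_bigcupr (_ : \bigcup_k _ = setT) ?setXTT//.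
  apply/seteqP; split => // t _; exists (Num.truncn `|t|).+1 => //=.
  by rewrite in_itv/= (le_lt_trans (ler_norm t))// truncnS_gt.
- by move=> _ [B [a [mB ->]]]; exact: m12.
- move=> k; apply: le_lt_trans m1T; apply: le_measure; rewrite ?inE//.
  exact: measurableX.
Qed.

(** For [n > 0] it is 1 up to [a - 1/n], 0 from [a] on and linear in between; vanishing at [a] is
    what yields the open half-line in the limit. *)
Definition ramp (a : R) (n : nat) (s : R) : R :=
  Order.max 0 (Order.min 1 (n%:R * (a - s))).

Lemma ramp01 a n s : 0 <= ramp a n s <= 1.
Proof. by rewrite /ramp le_max lexx/= ge_max ler01/= ge_min lexx. Qed.

Lemma continuous_ramp a n : continuous (ramp a n).
Proof.
move=> s.
apply: (@continuous_max R R (cst 0) ((cst 1) \min (fun s => n%:R * (a - s)))).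
  exact: cvg_cst.
apply: (@continuous_min R R (cst 1) (fun s => n%:R * (a - s))).
  exact: cvg_cst.
apply: cvgM; first exact: cvg_cst.
by apply: cvgB; [exact: cvg_cst|exact: cvg_id].
Qed.

Lemma cvg_ramp a s : ramp a n s @[n --> \oo] --> (\1_(`]-oo, a[%classic) s : R).
Proof.
rewrite indicE mem_setE in_itv/=; have [sa|sa] := ltP s a; last first.
  rewrite (_ : (fun n => ramp a n s) = cst 0); first exact: cvg_cst.
  apply/funext => n; rewrite /ramp/= max_l// ge_min; apply/orP; right.
  by rewrite mulr_ge0_le0// subr_le0.
have as0 : 0 < a - s by rewrite subr_gt0.
apply: (cvg_trans (G := (fun=> 1) @ \oo)); last exact: cvg_cst.
apply: near_eq_cvg; exists (Num.truncn (a - s)^-1).+1 => // n /= an.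
have : 1 <= n%:R * (a - s).
  rewrite -ler_pdivrMr// div1r (le_trans (ltW (truncnS_gt _)))//.
  by rewrite ler_nat.
by move=> h; rewrite /ramp min_l// max_r.
Qed.

Lemma ramp_test_function (G : X -> R -> R) (B : set X) (a : R) (n : nat) :
  measurable B -> test_function G (fun z => \1_B z.1 * ramp a n z.2).
Proof.
move=> mB.
have fM (z : X * R) : `|\1_B z.1 * ramp a n z.2| <= 1.
  have /andP[r0 r1] := ramp01 a n z.2.
  rewrite normrM (ger0_norm r0) indicE; case: (_ \in _).
    by rewrite normr1 mul1r.
  by rewrite normr0 mul0r.
split.
- apply: measurable_funM.
    by apply: measurableT_comp => //; exact: measurable_indic.
  apply: (measurableT_comp (f := ramp a n)) => //.
  by apply: continuous_measurable_fun; exact: continuous_ramp.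
- by exists 1 => z _; exact: fM.
- move=> x; apply: (@continuous_subspaceT _ _ _ (fun t : R => \1_B x * ramp a n t)).
  move=> t; apply: (@cvgM _ R (nbhs t) _ (cst (\1_B x)) (ramp a n)).
    exact: cvg_cst.
  exact: continuous_ramp.
Qed.

Lemma measure_ramp_limit (m : {measure set (X * R) -> \bar R}) (B : set X) (a : R) :
    m setT = 1%E -> measurable B ->
  (\int[m]_z (\1_B z.1 * ramp a n z.2))%R @[n --> \oo] -->
    fine (m (B `*` `]-oo, a[%classic)).
Proof.
move=> m1 mB.
have mBa : measurable (B `*` `]-oo, a[%classic) by exact: measurableX.
have -> : fine (m (B `*` `]-oo, a[%classic)) =
    (\int[m]_z (\1_B z.1 * \1_(`]-oo, a[%classic) z.2))%R.
  rewrite /Rintegral -[in LHS](setIT (B `*` _)) -integral_indic//; congr fine.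
  apply: eq_integral => z _; congr EFin.
  rewrite !indicE in_setX; case: (_ \in B); case: (_ \in _);
    by rewrite ?mulr1 ?mulr0 ?mul0r.
apply: (@Rintegral_dominated_cvg _ _ _ m (fun n z => \1_B z.1 * ramp a n z.2) _ (cst 1)).
(* The zero function is a dummy [G]: only measurability is extracted. *)
- by move=> n; have [] := ramp_test_function (fun _ _ => 0) a n mB.
- by move=> z; apply: cvgM; [exact: cvg_cst|exact: cvg_ramp].
- by apply: (integrable_bounded (M := 1)) => // [|z]; rewrite ?m1 ?ltry ?normr1.
- move=> n z; have /andP[r0 r1] := ramp01 a n z.2.
  rewrite normrM (ger0_norm r0) indicE; case: (_ \in _).
    by rewrite normr1 mul1r.
  by rewrite normr0 mul0r.
Qed.

Lemma generated_kernel_unique (P : R.-pker X ~> X) (G g : X -> R -> R)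
    (p q : R -> R.-pker (X * R)%type ~> (X * R)%type) (t : R) (z : X * R) :
    sojourn_law G g -> generated_by P G g p -> generated_by P G g q ->
    0 <= t -> state_space G z ->
  forall A, measurable A -> p t z A = q t z A.
Proof.
move=> hG hp hq t0 Dz; apply: measure_lower_rectangles_unique.
  by rewrite prob_kernel ltry.
move=> B a mB.
have mBa : measurable (B `*` `]-oo, a[%classic) by exact: measurableX.
have fin (k : R.-pker (X * R)%type ~> (X * R)%type) :
    k z (B `*` `]-oo, a[%classic) \is a fin_num.
  rewrite ge0_fin_numE//; apply: (@le_lt_trans _ _ (k z setT)).
    by apply: le_measure; rewrite ?inE.
  by rewrite prob_kernel ltry.
rewrite -(fineK (fin (p t))) -(fineK (fin (q t))); congr EFin.
have Lp := @measure_ramp_limit (p t z) B a (@prob_kernel _ _ _ _ _ (p t) z) mB.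
have Lq := @measure_ramp_limit (q t z) B a (@prob_kernel _ _ _ _ _ (q t) z) mB.
suff E : (fun n => \int[p t z]_y (\1_B y.1 * ramp a n y.2))%R =
         (fun n => \int[q t z]_y (\1_B y.1 * ramp a n y.2))%R.
  by rewrite E in Lp; exact: cvg_unique Lp Lq.
apply/funext => n; apply: (generated_semigroup_unique hG hp hq (M := 1)) => //.
  exact: ramp_test_function.
move=> y; have /andP[r0 r1] := ramp01 a n y.2.
rewrite normrM (ger0_norm r0) indicE; case: (_ \in _).
  by rewrite normr1 mul1r.
by rewrite normr0 mul0r.
Qed.

End Determination.

(** * The law of the semi-Markov process *)

Section SemiMarkovLaw.
Context {d dO : measure_display} {X : measurableType d}
        {Om : measurableType dO} {R : realType}.
Variable Pr : probability Om R.
Variables (xi : nat -> {mfun Om >-> X}) (tau : nat -> {RV Pr >-> R}).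

(** The pairs at which the supremum in [jump_count] is attained at [n], taken jointly in time and
    outcome for the later use of Fubini. *)
Let last_jump (n : nat) : set (R * Om) :=
  [set tw | tau n tw.2 <= tw.1 /\ forall m, tau m tw.2 <= tw.1 -> (m <= n)%N].

Let measurable_tau_le n : measurable [set tw : R * Om | tau n tw.2 <= tw.1].
Proof.
have mf : measurable_fun [set: R * Om] (fun tw => tau n tw.2 - tw.1).
  by apply: measurable_funB => //; exact: measurableT_comp.
have := mf measurableT _ (measurable_itv `]-oo, (0 : R)]).
by rewrite setTI; congr measurable; apply/seteqP; split=> tw /=;
  rewrite in_itv/= subr_le0.
Qed.

Let measurable_last_jump n : measurable (last_jump n).
Proof.
have -> : last_jump n = [set tw : R * Om | tau n tw.2 <= tw.1] `&`
    \bigcap_(m in [set m | (n < m)%N]) ~` [set tw : R * Om | tau m tw.2 <= tw.1].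
  apply/seteqP; split => tw /= [ntw tw_le]; split => // m.
    by move=> /= nm /tw_le; rewrite leqNgt nm.
  by move=> mtw; rewrite leqNgt; apply/negP => nm; exact: tw_le m nm mtw.
apply: measurableI => //; apply: bigcap_measurable; last first.
  by move=> m _; exact: measurableC.
by exists n.+1 => /=.
Qed.

Lemma jump_count_last t w n : last_jump n (t, w) -> jump_count tau t w = n.
Proof.
move=> [/= nt max_n]; apply: xget_unique; first by split.
move=> m [/= mt max_m]; apply/eqP; rewrite eqn_leq.
by rewrite max_n// max_m.
Qed.

(** The default value of [jump_count] puts every pair without a last jump into level 0, hence the
    extra set for [n = 0]. *)
Let measurable_jump_count n :
  measurable [set tw : R * Om | jump_count tau tw.1 tw.2 = n].
Proof.
have -> : [set tw : R * Om | jump_count tau tw.1 tw.2 = n] =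
    last_jump n `|` (if n == 0%N then ~` (\bigcup_m last_jump m) else set0).
  apply/seteqP; split => [[t w] /= jn|[t w] /= [|]].
  - have [[m mtw]|nm] := pselect (exists m, last_jump m (t, w)).
      by left; rewrite -jn (jump_count_last mtw).
    right; suff -> : n = 0%N by move=> [m _ mtw]; apply: nm; exists m.
    rewrite -jn /jump_count; case: xgetP => // m _ [mt max_m].
    by case: nm; exists m.
  - by move/jump_count_last.
  - case: eqP => // -> nm; rewrite /jump_count; case: xgetP => // m _ [mt max_m].
    by case: nm; exists m.
apply: measurableU => //; case: ifP => // _.
by apply: measurableC; exact: bigcup_measurable.
Qed.

Lemma measurable_sm_pair :
  measurable_fun [set: R * Om] (fun tw => sm_pair xi tau tw.1 tw.2).
Proof.
move=> _ B mB; rewrite setTI.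
have -> : (fun tw : R * Om => sm_pair xi tau tw.1 tw.2) @^-1` B =
    \bigcup_n ([set tw : R * Om | jump_count tau tw.1 tw.2 = n] `&`
      (fun tw : R * Om => (xi n tw.2, tw.1 - tau n tw.2)) @^-1` B).
  apply/seteqP; split => [tw /= Btw|tw [n _ [/= <-]]//].
  by exists (jump_count tau tw.1 tw.2).
apply: bigcupT_measurable => n; apply: measurableI => //.
rewrite -[X in measurable X]setTI.
suff : measurable_fun [set: R * Om] (fun tw => (xi n tw.2, tw.1 - tau n tw.2)) by apply.
apply: measurable_fun_pair; first exact: measurableT_comp.
by apply: measurable_funB => //; exact: measurableT_comp.
Qed.

Lemma measurable_sm_pair_at t : measurable_fun [set: Om] (sm_pair xi tau t).
Proof.
exact: (measurable_fun_pair2 (f := fun tw => sm_pair xi tau tw.1 tw.2) t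
  measurable_sm_pair).
Qed.

Variables (P : R.-pker X ~> X) (G g : X -> R -> R) (x : X).
Hypotheses (hG : sojourn_law G g) (hrenewal : markov_renewal xi tau P G)
  (hxi0 : forall w, xi 0%N w = x) (htau0 : forall w, tau 0%N w = 0).

(** Further jumps at time 0 could move the process at once. The renewal identity at [t = 0], with
    [G_x(0) = 0], makes nonpositive sojourns null events, so almost surely the jump times increase
    strictly from 0. *)
Lemma sm_pair_start : {ae Pr, forall w, sm_pair xi tau 0 w = (x, 0)}.
Proof.
pose N n : set Om := [set w | tau n.+1 w - tau n w <= 0].
have mN n : measurable (N n).
  have mf : measurable_fun [set: Om] (fun w => tau n.+1 w - tau n w).
    exact: measurable_funB.
  have := mf measurableT _ (measurable_itv `]-oo, (0 : R)]).
  by rewrite setTI; congr measurable; apply/seteqP; split=> w /=; rewrite in_itv.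
have N0 n : Pr (N n) = 0%E.
  have FT : renewal_filtration xi tau n setT.
    have [F0 FC _] := smallest_sigma_algebra setT [set A | exists k : nat, (k <= n)%N /\
        ((exists2 B : set X, measurable B & A = xi k @^-1` B) \/
         (exists2 B : set R, measurable B & A = tau k @^-1` B))].
    by have := FC _ F0; rewrite setD0.
  have := hrenewal FT (@measurableT _ X) (lexx 0).
  rewrite setTI integral0_eq => [<-|w _].
    by congr (Pr _); apply/seteqP; split => w /= => [|[]].
  by rewrite /semi_markov_kernel (sojourn0 hG) mule0.
have negN : Pr.-negligible (\bigcup_n N n).
  apply: negligible_bigcup => n; exists (N n); split => //; exact: (N0 n).
apply: negligibleS negN.
move=> w /=; apply: contra_notP => nN.
have tau_inc n : tau n w < tau n.+1 w.
  rewrite ltNge; apply/negP => le; apply: nN; exists n => //=.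
  by rewrite /N/= subr_le0.
have tau_pos n : 0 < tau n.+1 w.
  by elim: n => [|n IHn]; [rewrite -(htau0 w)|exact: lt_trans IHn _].
have J0 : jump_count tau 0 w = 0%N.
  apply: jump_count_last; split => /=; first by rewrite htau0.
  by move=> [|m]// ; rewrite leNgt tau_pos.
by rewrite /sm_pair /semi_markov /backward_recurrence J0 hxi0 htau0 subr0.
Qed.

Lemma sm_pair_law (p : R -> R.-pker (X * R)%type ~> (X * R)%type) (t : R)
    (B : set (X * R)) :
    markov_with_transition Pr (sm_pair xi tau) p -> 0 <= t -> measurable B ->
  Pr (sm_pair xi tau t @^-1` B) = p t (x, 0) B.
Proof.
move=> hM t0 mB.
have FT : natural_filtration (sm_pair xi tau) 0 setT.
  have [F0 FC _] := smallest_sigma_algebra setT [set A | exists2 s : R, 0 <= s <= 0 &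
        exists2 B : set (X * R), measurable B & A = sm_pair xi tau s @^-1` B].
  by have := FC _ F0; rewrite setD0.
have := hM t 0 setT B t0 (lexx 0) FT mB.
rewrite setTI add0r => ->.
rewrite (@ae_eq_integral _ _ _ Pr setT (cst (p t (x, 0) B)))//.
- by rewrite integral_cst// [X in (_ * X)%E]probability_setT mule1.
- exact: (measurableT_comp (measurable_kernel (p t) B mB) (measurable_sm_pair_at 0)).
- by have := sm_pair_start; apply: filterS => w -> _.
Qed.

(** Positive and negative parts are transported separately, so the identity holds at every time,
    even where the integrals are infinite. *)
Lemma Rintegral_sm_pair (p : R -> R.-pker (X * R)%type ~> (X * R)%type) (t : R)
    (s : X * R -> R) :
    markov_with_transition Pr (sm_pair xi tau) p -> 0 <= t ->
    measurable_fun setT s ->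
  (\int[Pr]_w s (sm_pair xi tau t w))%R = (\int[p t (x, 0)%R]_z s z)%R.
Proof.
move=> hM t0 ms; congr fine.
have nonneg (f : X * R -> \bar R) : measurable_fun setT f -> (forall z, 0 <= f z)%E ->
    (\int[Pr]_w f (sm_pair xi tau t w) = \int[p t (x, 0)%R]_z f z)%E.
  move=> mf f0.
  have := ge0_integral_pushforward (measurable_sm_pair_at t) Pr measurableT mf.
  rewrite preimage_setT => <- //.
  apply: eq_measure_integral; first exact: measurable_sm_pair_at.
  by move=> mt B mB _; exact: sm_pair_law hM t0 mB.
have mes : measurable_fun setT (EFin \o s) by exact/measurable_EFinP.
rewrite [LHS]integralE [RHS]integralE; congr (_ - _)%E.
  rewrite -[RHS](nonneg _ (measurable_funepos mes) (funepos_ge0 _)).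
  apply: eq_integral => w _.
  exact: (congr1 (@^~ w) (funepos_comp (EFin \o s) (sm_pair xi tau t))).
rewrite -[RHS](nonneg _ (measurable_funeneg mes) (funeneg_ge0 _)).
apply: eq_integral => w _.
exact: (congr1 (@^~ w) (funeneg_comp (EFin \o s) (sm_pair xi tau t))).
Qed.

End SemiMarkovLaw.

(** * Exchanging expectation and time integral *)

Section FubiniReal.
Context {d1 d2 : measure_display} {T1 : measurableType d1}
  {T2 : measurableType d2} {R : realType}.
Variables (m1 : {sigma_finite_measure set T1 -> \bar R})
  (m2 : {sigma_finite_measure set T2 -> \bar R}) (f : T1 * T2 -> R).
Hypothesis (mf : measurable_fun setT f).
Hypothesis (intf : (\int[m1]_x \int[m2]_y `|f (x, y)|%:E < +oo)%E).

Let mef : measurable_fun setT (EFin \o f). Proof. exact/measurable_EFinP. Qed.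

Let intef : (m1 \x m2)%E.-integrable setT (EFin \o f).
Proof. exact/integrable12ltyP. Qed.

Let intG : m2.-integrable setT (fubini_G m1 (EFin \o f)).
Proof.
have mswap : measurable_fun setT (EFin \o (fun yx : T2 * T1 => f (yx.2, yx.1))).
  apply/measurable_EFinP; apply: (measurableT_comp (f := f)) => //.
  exact: measurable_swap.
have intswap : (m2 \x m1)%E.-integrable setT
    (EFin \o (fun yx : T2 * T1 => f (yx.2, yx.1))).
  apply/(integrable12ltyP _ _ mswap); exact: (integrable21ltyP _ _ mef).1 intef.
exact: integrable_fubini_F intswap.
Qed.

(** Inner integrals in Fubini are finite only almost everywhere; [fine] alters them on a null set
    alone. *)
Let ae_fine {d} {T : measurableType d} (m : {measure set T -> \bar R})
    (h : T -> \bar R) : m.-integrable setT h ->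
  m.-integrable setT (fun x => (fine (h x))%:E) /\
  (\int[m]_x (fine (h x))%:E = \int[m]_x h x)%E.
Proof.
move=> ih; have mh := measurable_int _ ih.
have mfh : measurable_fun setT (fun x => (fine (h x))%:E).
  by apply/measurable_EFinP; exact: measurableT_comp.
have aefh : ae_eq m setT h (fun x => (fine (h x))%:E).
  have := integrable_ae measurableT ih.
  by apply: filterS => x /(_ Logic.I) fx _; rewrite fineK.
split; last by apply: ae_eq_integral => //; exact: ae_eq_sym.
apply: le_integrable ih => //.
by move=> x _; case: (h x) => [y||]//=; rewrite ?normr0 ?leey.
Qed.

Lemma integrable_Rintegral_section :
  m1.-integrable setT (EFin \o (fun x => (\int[m2]_y f (x, y))%R)).
Proof. by have [] := ae_fine (integrable_fubini_F intef). Qed.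

Lemma Rintegral_Fubini :
  (\int[m1]_x (\int[m2]_y f (x, y)))%R = (\int[m2]_y (\int[m1]_x f (x, y)))%R.
Proof.
congr fine.
have [_ EF] := ae_fine (integrable_fubini_F intef).
have [_ EG] := ae_fine intG.
exact: etrans EF (etrans (Fubini intef) (esym EG)).
Qed.

End FubiniReal.

(** If [f] is not integrable and [c] is nonzero, then neither is [c f]; both integrals are infinite
    and [fine] sends them to 0. *)
Lemma RintegralZl_measurable {d : measure_display} {T : measurableType d}
    {R : realType} (m : {measure set T -> \bar R}) (c : R) (f : T -> R) :
    measurable_fun setT f ->
  (\int[m]_x (c * f x))%R = c * (\int[m]_x f x)%R.
Proof.
move=> mf; have [->|c0] := eqVneq c 0.
  rewrite mul0r; under eq_Rintegral do rewrite mul0r.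
  by rewrite Rintegral_cst// mul0r.
have [intf|nintf] := pselect (m.-integrable setT (EFin \o f)).
  by rewrite RintegralZl.
have not_integrable (h : T -> R) : measurable_fun setT h ->
    ~ m.-integrable setT (EFin \o h) -> (\int[m]_x h x)%R = 0.
  move=> mh nh; have meh : measurable_fun setT (EFin \o h) by exact/measurable_EFinP.
  have : ~~ (\int[m]_x (h x)%:E \is a fin_num)%E.
    apply/negP; rewrite -integral_fin_num_abs// => hfin; apply: nh.
    by apply/integrableP; split.
  by rewrite fin_numE negb_and !negbK /Rintegral => /orP[] /eqP ->.
rewrite !not_integrable ?mulr0//; first exact: measurable_funM.
move=> intcf; apply: nintf.
have := integrableZl measurableT c^-1 intcf; apply: eq_integrable => // x _ /=.
by rewrite -EFinM mulKf.
Qed.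

(** * Expected time integrals in terms of the semigroup *)

Section TimeAverages.
Context {d dO : measure_display} {X : measurableType d}
        {Om : measurableType dO} {R : realType}.
Variables (Pr : probability Om R) (P : R.-pker X ~> X) (G g : X -> R -> R)
  (xi : nat -> {mfun Om >-> X}) (tau : nat -> {RV Pr >-> R}) (x : X)
  (etQ : R -> R.-pker (X * R)%type ~> (X * R)%type).
Hypotheses (hG : sojourn_law G g) (hrenewal : markov_renewal xi tau P G)
  (hxi0 : forall w, xi 0%N w = x) (htau0 : forall w, tau 0%N w = 0)
  (hMarkov : markov_with_generator Pr (sm_pair xi tau) P G g)
  (hetQ : generated_by P G g etQ).

Lemma Rintegral_sm_pair_semigroup (t : R) (s : X * R -> R) :
    0 <= t -> measurable_fun setT s ->
  (\int[Pr]_w s (sm_pair xi tau t w))%R = semigroup_op etQ t s (x, 0).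
Proof.
move=> t0 ms; have [p hp hMp] := hMarkov.
rewrite (Rintegral_sm_pair hG hrenewal hxi0 htau0 hMp t0 ms).
congr fine; apply: eq_measure_integral => B mB _.
apply: (generated_kernel_unique hG hp hetQ t0 _ mB).
exact: (state_space_age0 hG).
Qed.

Variables (T : R) (c : R -> R) (s : X * R -> R).
Hypotheses (mc : measurable_fun `[0, T] c) (ms : measurable_fun setT s)
  (fin : (\int[Pr]_w \int[lebesgue_measure]_(t in `[0%R, T])
           `|c t * s (sm_pair xi tau t w)|%:E < +oo)%E).

(** [c] is known to be measurable on [[0, T]] only, hence its extension by 0; the outcome comes
    first to match the order of integration in [fin]. *)
Let F (wt : Om * R) : R := (c \_ `[0, T]) wt.2 * s (sm_pair xi tau wt.2 wt.1).

Let mF : measurable_fun setT F.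
Proof.
apply: measurable_funM.
  apply: (measurableT_comp (f := c \_ `[0, T]) (g := snd)) => //.
  exact/(measurable_restrictT c (measurable_itv _)).
apply: measurableT_comp => //.
apply: (measurableT_comp (f := fun tw : R * Om => sm_pair xi tau tw.1 tw.2)
  (g := fun wt : Om * R => (wt.2, wt.1))).
  exact: measurable_sm_pair.
exact: measurable_swap.
Qed.

Let FE w : (\int[lebesgue_measure]_(t in `[0, T]) (c t * s (sm_pair xi tau t w)))%R
  = (\int[lebesgue_measure]_t F (w, t))%R.
Proof.
rewrite Rintegral_mkcond; apply: eq_Rintegral => t _.
by rewrite /F !patchE/=; case: ifP => // _; rewrite mul0r.
Qed.

Let finF : (\int[Pr]_w \int[lebesgue_measure]_t `|F (w, t)|%:E < +oo)%E.
Proof.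
apply: le_lt_trans fin; rewrite le_eqVlt; apply/orP; left; apply/eqP.
apply: eq_integral => w _; rewrite [RHS]integral_mkcond; apply: eq_integral => t _.
by rewrite /F !patchE/=; case: ifP => // _; rewrite mul0r normr0.
Qed.

Lemma integrable_time_integral :
  Pr.-integrable setT (EFin \o (fun w =>
    (\int[lebesgue_measure]_(t in `[0, T]) (c t * s (sm_pair xi tau t w)))%R)).
Proof.
have := @integrable_Rintegral_section _ _ _ _ _ Pr lebesgue_measure F mF finF.
by apply: eq_integrable => // w _ /=; rewrite FE.
Qed.

Lemma expectation_time_integral :
  (\int[Pr]_w (\int[lebesgue_measure]_(t in `[0, T])
     (c t * s (sm_pair xi tau t w))))%R =
  (\int[lebesgue_measure]_(t in `[0, T]) (c t * semigroup_op etQ t s (x, 0)))%R.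
Proof.
under eq_Rintegral do rewrite FE.
rewrite (@Rintegral_Fubini _ _ _ _ _ Pr lebesgue_measure F mF finF) [RHS]Rintegral_mkcond.
apply: eq_Rintegral => t _; rewrite /F/= !patchE; case: ifPn => tT; last first.
  under eq_Rintegral do rewrite mul0r.
  by rewrite Rintegral_cst// mul0r.
have t0 : 0 <= t by move: tT; rewrite inE/= in_itv/= => /andP[].
rewrite -Rintegral_sm_pair_semigroup// RintegralZl_measurable//.
by apply: measurableT_comp => //; exact: measurable_sm_pair_at.
Qed.

End TimeAverages.

(** * Zero-order value of the correlation swap *)

Unset Implicit Arguments.

Theorem theorem4 (R : realType) (d dO : measure_display)
  (X : measurableType d) (Om : measurableType dO) (Pr : probability Om R)
  (P : R.-pker X ~> X) (G g : X -> R -> R)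
  (xi : nat -> {mfun Om >-> X}) (tau : nat -> {RV Pr >-> R}) (x : X)
  (etQ : R -> R.-pker (X * R)%type ~> (X * R)%type)
  (T r K : R) (rho : R -> R) (sigma1 sigma2 : X * R -> R)
  (hG : sojourn_law G g)
  (hrenewal : markov_renewal xi tau P G)
  (hregular : non_explosive tau)
  (hxi0 : forall w, xi 0%N w = x)
  (htau0 : forall w, tau 0%N w = 0)
  (hMarkov : markov_with_generator Pr (sm_pair xi tau) P G g)
  (hetQ : generated_by P G g etQ)
  (hT : 0 < T)
  (hrho : measurable_fun `[0, T] rho)
  (hsigma1 : measurable_fun setT sigma1)
  (hsigma2 : measurable_fun setT sigma2)
  (hX : (\int[Pr]_w \int[lebesgue_measure]_(t in `[0%R, T])
           `|rho t * sigma1 (sm_pair xi tau t w)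
                   * sigma2 (sm_pair xi tau t w)|%:E < +oo)%E)
  (hY : (\int[Pr]_w \int[lebesgue_measure]_(t in `[0%R, T])
           ((sigma1 (sm_pair xi tau t w)) ^+ 2)%:E < +oo)%E)
  (hZ : (\int[Pr]_w \int[lebesgue_measure]_(t in `[0%R, T])
           ((sigma2 (sm_pair xi tau t w)) ^+ 2)%:E < +oo)%E) :
  let cov := realized_cov (sm_pair xi tau) T rho sigma1 sigma2 in
  let var1 := realized_var (sm_pair xi tau) T sigma1 in
  let var2 := realized_var (sm_pair xi tau) T sigma2 in
  let Y0 := fine 'E_Pr[var1] in
  let Z0 := fine 'E_Pr[var2] in
  let corr0 := fun w => corr_coef (cov w) Y0 Z0 in
  let P_corr0 := expR (- r * T) *
    ((\int[lebesgue_measure]_(t in `[0, T])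
        (rho t * semigroup_op etQ t (fun z => sigma1 z * sigma2 z) (x, 0)))%R
     / (Num.sqrt (\int[lebesgue_measure]_(t in `[0, T])
          semigroup_op etQ t (fun z => sigma1 z ^+ 2) (x, 0))%R
        * Num.sqrt (\int[lebesgue_measure]_(t in `[0, T])
            semigroup_op etQ t (fun z => sigma2 z ^+ 2) (x, 0))%R)
     - K) in
  0 < Y0 -> 0 < Z0 ->
  corr_swap_value Pr r T K corr0 = P_corr0%:E /\
  P_corr0%:E = ((expR (- r * T))%:E * ('E_Pr[corr0] - K%:E))%E.
Proof.
move=> cov var1 var2 Y0 Z0 corr0 P_corr0 Y0_gt0 Z0_gt0.
pose Cv := (\int[lebesgue_measure]_(t in `[0, T])
   (rho t * semigroup_op etQ t (fun z => sigma1 z * sigma2 z) (x, 0)))%R.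
pose V (s : X * R -> R) := (\int[lebesgue_measure]_(t in `[0, T])
   semigroup_op etQ t (fun z => s z ^+ 2) (x, 0))%R.
have VE (s : X * R -> R) : measurable_fun setT s ->
    (\int[Pr]_w \int[lebesgue_measure]_(t in `[0%R, T])
      ((s (sm_pair xi tau t w)) ^+ 2)%:E < +oo)%E ->
    fine 'E_Pr[realized_var (sm_pair xi tau) T s] = T^-1 * V s.
  move=> ms fins; rewrite unlock -/(Rintegral _ _ _) /realized_var.
  have ms2 : measurable_fun setT (fun z => s z ^+ 2) by exact: measurable_funX.
  (* The variances are the time integrals with unit weight [c = 1]. *)
  have fins1 : (\int[Pr]_w \int[lebesgue_measure]_(t in `[0%R, T])
      `|1 * (s (sm_pair xi tau t w)) ^+ 2|%:E < +oo)%E.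
    apply: le_lt_trans fins; rewrite le_eqVlt; apply/orP; left; apply/eqP.
    apply: eq_integral => w _; apply: eq_integral => t _.
    by rewrite mul1r ger0_norm// sqr_ge0.
  have int1 := integrable_time_integral (c := cst 1) (measurable_cst _) ms2 fins1.
  have E1 := expectation_time_integral hG hrenewal hxi0 htau0 hMarkov hetQ
    (c := cst 1) (measurable_cst _) ms2 fins1.
  transitivity (T^-1 * (\int[Pr]_w (\int[lebesgue_measure]_(t in `[0%R, T])
      (cst 1 t * s (sm_pair xi tau t w) ^+ 2)))%R).
    rewrite -RintegralZl//; apply: eq_Rintegral => w _; congr (_ * _).
    by apply: eq_Rintegral => t _; rewrite mul1r.
  by rewrite E1; congr (_ * _); apply: eq_Rintegral => t _; rewrite mul1r.
have Y0E : Y0 = T^-1 * V sigma1 by exact: VE.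
have Z0E : Z0 = T^-1 * V sigma2 by exact: VE.
have msig : measurable_fun setT (fun z => sigma1 z * sigma2 z).
  exact: measurable_funM.
have hX' : (\int[Pr]_w \int[lebesgue_measure]_(t in `[0%R, T])
    `|rho t * (sigma1 (sm_pair xi tau t w) * sigma2 (sm_pair xi tau t w))|%:E < +oo)%E.
  apply: le_lt_trans hX; rewrite le_eqVlt; apply/orP; left; apply/eqP.
  by apply: eq_integral => w _; apply: eq_integral => t _; rewrite mulrA.
have intX := integrable_time_integral hrho msig hX'.
have EX := expectation_time_integral hG hrenewal hxi0 htau0 hMarkov hetQ
  hrho msig hX'.
pose A w := (\int[lebesgue_measure]_(t in `[0%R, T])
  (rho t * (sigma1 (sm_pair xi tau t w) * sigma2 (sm_pair xi tau t w))))%R.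
pose k := T^-1 / (Num.sqrt Y0 * Num.sqrt Z0).
have corr0E w : corr0 w = k * A w.
  rewrite /corr0 /corr_coef /cov /realized_cov /k mulrAC; congr (_ * _ * _).
  by apply: eq_Rintegral => t _; rewrite mulrA.
have intcorr : Pr.-integrable setT (EFin \o corr0).
  have := integrableZl measurableT k intX.
  by apply: eq_integrable => // w _ /=; rewrite corr0E -EFinM.
have corrE : (\int[Pr]_w corr0 w)%R = k * Cv.
  under eq_Rintegral do rewrite corr0E.
  by rewrite RintegralZl// EX.
(* Each mean variance carries a factor [T^-1]; the two square roots of it multiply to [T^-1] and
   cancel the one of the covariance. *)
have kE : k * Cv = Cv / (Num.sqrt (V sigma1) * Num.sqrt (V sigma2)).
  have Ti : 0 <= T^-1 by rewrite invr_ge0 ltW.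
  rewrite /k Y0E Z0E !sqrtrM// mulrACA -expr2 sqr_sqrtr//.
  by rewrite invfM mulrA divff ?invr_eq0 ?gt_eqF// mul1r mulrC.
have Ecorr : ('E_Pr[corr0] = (k * Cv)%:E)%E.
  rewrite unlock -corrE /Rintegral fineK//.
  exact: (integrable_fin_num _ intcorr).
have P0E : P_corr0 = expR (- r * T) * (k * Cv - K) by rewrite kE.
split.
  rewrite P0E /corr_swap_value unlock -corrE.
  have iK : Pr.-integrable setT (EFin \o cst K).
    apply: (integrable_bounded (M := `|K|)) => //.
    by rewrite [ltLHS]probability_setT ltry.
  have iB : Pr.-integrable setT (EFin \o (fun w => corr0 w - K)).
    by have := integrableB measurableT intcorr iK; apply: eq_integrable.
  have cK : (\int[Pr]_w cst K w)%R = K.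
    by rewrite Rintegral_cst// [X in fine X]probability_setT mulr1.
  rewrite -[X in _ - X]cK -RintegralB// -RintegralZl// /Rintegral fineK//.
  apply: (integrable_fin_num measurableT).
  by have := integrableZl measurableT (expR (- r * T)) iB; apply: eq_integrable.
by rewrite P0E Ecorr -EFinB -EFinM.
Qed.
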